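(* Let $\Omega\subset\mathbb{R}^d$, $d\ge 1$, be a measurable domain and let $\sigma$ be a real-valued measurable function on $\Omega$ which is admissible (as defined in the context). Consider the associated function $$a_\sigma(e)=\mathrm{meas}\{x\in\Omega:\ \sigma(x)<e\}\in[0,\mathrm{meas}(\Omega)],\qquad e\in\mathbb{R},$$ and its pseudo-inverse $$b_\sigma(\mu)=\sup\{t<e_{max}:\ a_\sigma(t)\le\mu\},\qquad \mu\ge 0,$$ with the convention that $b_\sigma(\mu)=-\infty$ if $\{t<e_{max}:\ a_\sigma(t)\le\mu\}=\varnothing$. Assume that the following function $B_\sigma$ is well defined on $[0,\mathrm{meas}(\Omega)[$, i.e. $$B_\sigma(\mu)=\int_{\{x\in\Omega:\ a_\sigma(\sigma(x))<\mu\}}\sigma(x)\,dx\quad\text{is finite for all }\mu\in[0,\mathrm{meas}(\Omega)[.$$ Then: (i) The function $B_\sigma$ is convex on $[0,\mathrm{meas}(\Omega)[$. (ii) Let $$H_\sigma(\mu)=\inf_{0<s\le\mu}\frac{B_\sigma(\mu+s)+B_\sigma(\mu-s)-2B_\sigma(\mu)}{s^2},\qquad \forall \mu>0,$$ and let $q\in L^1(\Omega)$ be any nonnegative and nonzero function such that $$K(q^*,\sigma)=4\int_0^{\|q\|_{L^\infty}}\frac{dt}{H_\sigma(\mu_q(t))}<\infty .$$ Then for any nonnegative function $f\in L^1(\Omega)$ we have $$\Big(\|f-q^{*\sigma}\|_{L^1}+\|q\|_{L^1}-\|f\|_{L^1}\Big)^2\le K(q^*,\sigma)\left[\int_\Omega\sigma(x)\,(f(x)-q^{*\sigma}(x))\,dx+\int_0^{+\infty}\Big[\beta_{f^*,q^*}(s)\,b_\sigma(2\mu_q(s))-\beta_{q^*,f^*}(s)\,b_\sigma(\mu_q(s))\Big]ds\right].$$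 In particular, the following refined Hardy-Littlewood type inequality holds for any nonnegative function $f\in L^1(\Omega)$ such that the quantity $K(f^*,\sigma)$ (defined by the same formula with $q$ replaced by $f$) is finite: $$\|f-f^{*\sigma}\|_{L^1}^2\le K(f^*,\sigma)\int_\Omega\sigma(x)\,(f(x)-f^{*\sigma}(x))\,dx .$$
   Context: $\mathrm{meas}$ denotes Lebesgue measure on $\mathbb{R}^d$; $\Omega\subset\mathbb{R}^d$ is a measurable domain, not necessarily bounded or of finite measure. For a nonnegative $q\in L^1(\Omega)$: $\mu_q(t)=\mathrm{meas}\{x\in\Omega:\ q(x)>t\}$ for $t\ge 0$; $q^\sharp(s)=\inf\{t\ge 0:\ \mu_q(t)\le s\}$ for $s\ge0$, with $q^\sharp(0)=\|q\|_{L^\infty}\in\mathbb{R}\cup\{+\infty\}$ and $q^\sharp(+\infty)=0$; the rearrangement of $q$ on $\Omega$ is $q^*(x)=q^\sharp\big(\mathrm{meas}(B_d(0,|x|)\cap\Omega)\big)$, $x\in\Omega$, where $B_d(0,r)$ is the ball of $\mathbb{R}^d$ centered at $0$ with radius $r$. One has $\mu_q=\mu_{q^*}$. A measurable function $\sigma$ on $\Omega$ is called admissible if, with $a_\sigma(e)=\mathrm{meas}\{x\in\Omega:\ \sigma(x)<e\}$: the set $\{e\in\mathbb{R}: a_\sigma(e)<\mathrm{meas}(\Omega)\}$ is not empty; $e_{min}:=\operatorname{ess\,inf}\sigma<e_{max}:=\sup\{e\in\mathbb{R}:\ a_\sigma(e)<\mathrm{meas}(\Omega)\}$ (where $e_{min}=-\infty$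 and/or $e_{max}=+\infty$ are allowed); $\mathrm{meas}\{x\in\Omega:\ \sigma(x)=e\}=0$ for all $e\in\,]-\infty,e_{max}[$; and $\lim_{e\to e_{max},\,e<e_{max}}a_\sigma(e)=\mathrm{meas}(\Omega)$. For such $\sigma$, the $\sigma$-rearrangement of a nonnegative $q\in L^1(\Omega)$ is $q^{*\sigma}(x)=q^\sharp(a_\sigma(\sigma(x)))\,\mathbf{1}_{\sigma(x)<e_{max}}$, $x\in\Omega$. For nonnegative $f,g\in L^1(\Omega)$: $\beta_{f,g}(s)=\mathrm{meas}\{x\in\Omega:\ f(x)\le s<g(x)\}$, $s\ge0$.
   Formalization: In H_σ, B_σ is continued beyond meas(Ω) with slope e_max (as the primitive of b_σ); otherwise (ii) is undefined or false, e.g. Ω=]0,1[, σ=x, q=1, f=0. The inequalities are asserted when the integrals exist in [-∞,∞] and, in (ii), the sum and product are not indeterminate. *)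

(* Defs.v *)
From HB Require Import structures.
From mathcomp Require Import all_boot all_order all_algebra.
From mathcomp Require Import all_classical all_reals all_analysis.
From mathcomp Require Import ess_sup_inf.

Set Implicit Arguments.
Unset Strict Implicit.
Unset Printing Implicit Defensive.

Import Order.TTheory GRing.Theory Num.Theory.
Import numFieldNormedType.Exports.

Local Open Scope classical_set_scope.
Local Open Scope ring_scope.
Local Open Scope ereal_scope.

(** * Lebesgue measure on R^d

   The Borel space is [d.-tuple R] with the product sigma-algebra.  On it,
   [borel_leb R d] is the d-fold product of the one-dimensional Lebesgue
   measure; [leb R d] is its completion, so that [measurable] on [Rd R d] means
   Lebesgue measurable. *)

Section lebesgue_cons.
Context {R : realType} {n : nat}.
Local Notation T := (measurableTypeR R).
Variable m : {sigma_finite_measure set (n.-tuple T) -> \bar R}.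

Definition tcons (xy : T * n.-tuple T) : n.+1.-tuple T :=
  [tuple of xy.1 :: xy.2].

Lemma measurable_tcons : measurable_fun setT tcons.
Proof. exact: measurable_cons. Qed.

Definition leb_cons : set (n.+1.-tuple T) -> \bar R :=
  pushforward ((@lebesgue_measure R) \x m) tcons.

Let leb_cons0 : leb_cons set0 = 0.
Proof. by rewrite /leb_cons /pushforward preimage_set0 measure0. Qed.

Let leb_cons_ge0 A : 0 <= leb_cons A.
Proof. by rewrite /leb_cons /pushforward measure_ge0. Qed.

Let leb_cons_sigma_additive : semi_sigma_additive leb_cons.
Proof.
move=> F mF tF mUF; rewrite /leb_cons /pushforward preimage_bigcup.
apply: measure_semi_sigma_additive.
- by move=> k; rewrite -[X in measurable X]setTI; exact: measurable_tcons.
- apply/trivIsetP => /= i j _ _ ij; rewrite -preimage_setI.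
  by move/trivIsetP : tF => /(_ _ _ _ _ ij) ->//; rewrite preimage_set0.
- by rewrite -preimage_bigcup -[X in measurable X]setTI;
    exact: measurable_tcons.
Qed.

HB.instance Definition _ := isMeasure.Build _ _ _ leb_cons
  leb_cons0 leb_cons_ge0 leb_cons_sigma_additive.

Let leb_cons_sigma_finite : sigma_finite setT leb_cons.
Proof.
pose l : {sigma_finite_measure set T -> \bar R} := @lebesgue_measure R.
have /sigma_finiteP[F [FT ndF Foo]] := sigma_finiteT l.
have /sigma_finiteP[G [GT ndG Goo]] := sigma_finiteT m.
pose tl (t : n.+1.-tuple T) : n.-tuple T := [tuple of behead t].
have tlE x y : tl (tcons (x, y)) = y by exact/val_inj.
exists (fun i => [set t | F i (thead t) /\ G i (tl t)]).
  apply/seteqP; split => // t _.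
  have [i _ Fi] : (\bigcup_i F i) (thead t) by rewrite -FT.
  have [j _ Gj] : (\bigcup_i G i) (tl t) by rewrite -GT.
  exists (maxn i j) => //; split.
  - by move: Fi; exact/subsetPset/ndF/leq_maxl.
  - by move: Gj; exact/subsetPset/ndG/leq_maxr.
move=> i; have [mF Fi] := Foo i; have [mG Gi] := Goo i; split.
  rewrite (_ : [set _ | _] = (@thead n T) @^-1` F i `&` tl @^-1` G i)//.
  apply: measurableI; rewrite -[X in measurable X]setTI.
    exact: measurable_tnth.
  exact: measurable_behead.
rewrite /leb_cons /pushforward (_ : _ @^-1` _ = F i `*` G i); last first.
  by apply/seteqP; split => -[x y]/=; rewrite theadE tlE.
by rewrite product_measure1E// lte_mul_pinfty// ge0_fin_numE.
Qed.

HB.instance Definition _ := Measure_isSigmaFinite.Build _ _ _ leb_cons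
  leb_cons_sigma_finite.

End lebesgue_cons.

Fixpoint borel_leb (R : realType) (d : nat) :
    {sigma_finite_measure set (d.-tuple (measurableTypeR R)) -> \bar R} :=
  match d with
  | 0 => dirac [tuple]
  | d'.+1 => leb_cons (borel_leb R d')
  end.

Definition Rd (R : realType) (d : nat) : measurableType _ :=
  caratheodory_type ((borel_leb R d)^*)%mu.

Section leb.
Variables (R : realType) (d : nat).

Definition leb_fun : set (Rd R d) -> \bar R :=
  @completed_measure_extension _ _ _ (borel_leb R d).

HB.instance Definition _ := Measure.on leb_fun.

Lemma leb_sigma_finite : sigma_finite setT leb_fun.
Proof. exact/completed_measure_extension_sigma_finite/sigma_finiteT. Qed.

HB.instance Definition _ := Measure_isSigmaFinite.Build _ _ _ leb_fun
  leb_sigma_finite.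

Definition leb : {sigma_finite_measure set (Rd R d) -> \bar R} := leb_fun.

End leb.

Section domain.
Context {R : realType} {d : nat}.
Local Notation mu := (leb R d).
Variable Om : set (Rd R d).

Implicit Types (q : Rd R d -> R) (f g : Rd R d -> \bar R).

Definition enorm (x : Rd R d) : R :=
  Num.sqrt (\sum_(i < d) tnth (x : d.-tuple R) i ^+ 2)%R.

Definition Bd (r : R) : set (Rd R d) := [set x | (enorm x < r)%R].

Definition L1norm f : \bar R := \int[mu]_(x in Om) `|f x|.

Definition Linfnorm (mOm : measurable Om) f : \bar R :=
  'N[mrestr mu mOm]_+oo[f].

(** ** Rearrangements *)

Definition mudist q (t : R) : \bar R := mu [set x | Om x /\ (t < q x)%R].

(* No special case is needed at the end points: the infimum is the essential
   supremum of [q] (possibly [+oo]) at [s = 0] and is [0] at [s = +oo]. *)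
Definition qsharp q (s : \bar R) : \bar R :=
  ereal_inf [set t%:E | t in [set t : R | (0 <= t)%R /\ mudist q t <= s]].

Definition qstar q (x : Rd R d) : \bar R :=
  qsharp q (mu (Bd (enorm x) `&` Om)).

Definition beta f g (s : R) : \bar R :=
  mu [set x | Om x /\ f x <= s%:E /\ s%:E < g x].

(** ** The weight [sigma] *)

Section weight.
Variable sigma : Rd R d -> R.

Definition asigma (e : R) : \bar R := mu [set x | Om x /\ (sigma x < e)%R].

Definition emax : \bar R :=
  ereal_sup [set e%:E | e in [set e : R | asigma e < mu Om]].

Definition emin (mOm : measurable Om) : \bar R :=
  ess_inf (mrestr mu mOm) (EFin \o sigma).

(* The limit is taken along the filter of left neighbourhoods of [emax] in
   [\bar R], which handles [emax = +oo] too; there [fine e] is the real [e]. *)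
Record admissible (mOm : measurable Om) : Prop := Admissible {
  adm_neq0 : [set e | asigma e < mu Om] !=set0 ;
  adm_lt : emin mOm < emax ;
  adm_level : forall e : R, e%:E < emax ->
    mu [set x | Om x /\ sigma x = e] = 0 ;
  adm_lim : asigma (fine e) @[e --> within [set e | e < emax] (nbhs emax)]
    --> mu Om }.

Definition qsigma q (x : Rd R d) : \bar R :=
  if (sigma x)%:E < emax then qsharp q (asigma (sigma x)) else 0.

(* The supremum of the empty set is [-oo]. *)
Definition bsigma (m : \bar R) : \bar R :=
  ereal_sup [set t%:E | t in [set t : R | t%:E < emax /\ asigma t <= m]].

Definition Bdom (m : R) : set (Rd R d) :=
  [set x | Om x /\ asigma (sigma x) < m%:E].

Definition Bsigma (m : R) : \bar R := \int[mu]_(x in Bdom m) (sigma x)%:E.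

(* [Hsigma] evaluates [Bsigma] at [m + s], which leaves [0, meas Om[ when
   [meas Om] is finite and [meas Om <= 2 m].  There [Bsigma], which on
   [0, meas Om[ is the primitive of [bsigma], is continued as the primitive of
   [bsigma], i.e. with slope [emax].  The second summand vanishes for
   [m <= meas Om], in particular always if [meas Om = +oo]. *)
Definition Bext (m : R) : \bar R :=
  Bsigma m + maxe 0 (m%:E - mu Om) * emax.

(* The dual addition sets [+oo - oo = +oo].  It differs from the usual one only
   if [Bext m = +oo], which requires [m >= meas Om] and [emax = +oo]. *)
Definition Bdiff2 (m s : R) : \bar R :=
  (Bext (m + s) + Bext (m - s) - 2%:E * Bext m)%dE.

Definition Hsigma (m : R) : \bar R :=
  ereal_inf [set Bdiff2 m s * ((s ^+ 2)^-1)%:E | s in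
             [set s : R | (0 < s <= m)%R]].

(* [mudist q t] is finite for [t > 0] and [q] integrable; the inverse on
   [\bar R] satisfies [0^-1 = +oo] and [+oo^-1 = 0]. *)
Definition Kqs (mOm : measurable Om) q : \bar R :=
  4%:E * \int[lebesgue_measure]_(t in
      [set t : R | (0 < t)%R /\ t%:E < Linfnorm mOm (EFin \o q)])
    (Hsigma (fine (mudist q t)))^-1.

Definition beta_term (f q : Rd R d -> R) (s : R) : \bar R :=
  beta (qstar f) (qstar q) s * bsigma (2%:E * mudist q s)
  - beta (qstar q) (qstar f) s * bsigma (mudist q s).

Definition sigma_term (f q : Rd R d -> R) (x : Rd R d) : \bar R :=
  (sigma x)%:E * ((f x)%:E - qsigma q x).

End weight.

End domain.

(* The integral of [f] over [D] exists in [\bar R]: it is not [+oo - oo]. *)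
Definition integral_exists {disp} {T : measurableType disp} {R : realType}
    (mu : {measure set T -> \bar R}) (D : set T) (f : T -> \bar R) : bool :=
  (\int[mu]_(x in D) f^\+ x) +? (- \int[mu]_(x in D) f^\- x).

(* Main.v *)
(** Write [E_t = {q^{*sigma} > t}] and [A_t = {f > t}].  By the layer-cake
    formula the quantity to be squared is twice the integral over [t] of
    [s_t = meas (E_t \ A_t)], and the energy gap is an integral over [t] of the
    cost of exchanging [E_t], a sublevel set of [sigma] of measure [m = mu_q t],
    with [A_t].  By the bathtub principle, and because [b_sigma] is a subgradient
    of [B_sigma], that cost is at least
    [B_sigma (m + s_t) + B_sigma (m - s_t) - 2 B_sigma m >= s_t^2 H_sigma m].
    The Cauchy-Schwarz inequality is used as the family of linear bounds
    [2 l s_t - l^2 s_t^2 H <= 1 / H], integrated over [t] and optimised in [l]. *)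
Require Import Defs.
From mathcomp Require Import all_boot all_order all_algebra.
From mathcomp Require Import all_classical all_reals all_analysis.
From mathcomp Require Import measurable_realfun ess_sup_inf ring lra.

Set Implicit Arguments.
Unset Strict Implicit.
Unset Printing Implicit Defensive.

Import Order.TTheory GRing.Theory Num.Theory.
Import numFieldNormedType.Exports.

Local Open Scope classical_set_scope.
Local Open Scope ring_scope.
Local Open Scope ereal_scope.

(** Put [p_t = meas (A_t \ E_t)]. In general [p_t - s_t = mu_f t - mu_q t] is not 0, and the [beta]
    terms pay for it. Comparing the union of [E_t] and [A_t], of measure [m + p_t], with a sublevel
    set of measure [m + s_t] costs [(s_t - p_t) b_sigma (m + s_t)]. This is at most
    [(s_t - p_t) b_sigma m] if [s_t < p_t] and, since [s_t <= m], at most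
    [(s_t - p_t) b_sigma (2 m)] otherwise: hence the argument [2 mu_q]. The obstacle is infinity:
    [sigma] may be unbounded, and [b_sigma] may be [-oo] at 0 and [+oo] from [meas Om] on. Costs are
    therefore carried as differences of nonnegative quantities, [P + F^+] against [N + F^-], with
    [N <= P + F^+] and [F^- <= P] on each level. Either [P] and [F^+] have finite integrals, and
    then so do [N] and [F^-], or the bracket on the right is [+oo]. In the linear form of
    Cauchy-Schwarz, [1 / H] occurs only as an upper bound, so a measurable minorant of it can be
    integrated. For [q = f] and [K = 0] the convention [0 * +oo = 0] makes the right-hand side
    vanish, and the gap is shown to be 0 directly. *)

(** * Layer-cake formulas *)

Section layer_cake.
Context d (T : measurableType d) (R : realType).
Variables (mu : {sigma_finite_measure set T -> \bar R}) (D : set T).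
Hypothesis mD : measurable D.
Variables w a b : T -> \bar R.
Hypotheses (mw : measurable_fun D w) (ma : measurable_fun D a)
  (mb : measurable_fun D b).

Definition band (t : R) : set T := [set x | D x /\ a x <= t%:E < b x].

Lemma measurable_band t : measurable (band t).
Proof.
rewrite (_ : band t = (D `&` [set x | a x <= t%:E]) `&` (D `&` [set x | t%:E < b x])).
  apply: measurableI; first exact: measurable_lee.
  exact: measurable_lte.
apply/seteqP; split => x /=.
  by move=> [Dx /andP[? ?]].
by move=> [[Dx ?] [_ ?]]; split => //; apply/andP.
Qed.

Let P : set (T * measurableTypeR R) :=
  [set z | (0 <= z.2)%R /\ band z.2 z.1].

Let mP : measurable P.
Proof.
have mDR : measurable (D `*` [set: measurableTypeR R]) by exact: measurableX.
have m2 : measurable_fun (D `*` [set: measurableTypeR R]) (fun z => z.2%:E : \bar R).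
  by apply: measurable_funTS; apply/measurable_EFinP; exact: measurable_snd.
have comp (g : T -> \bar R) : measurable_fun D g ->
    measurable_fun (D `*` [set: measurableTypeR R]) (fun z => g z.1).
  move=> mg; apply: (measurable_comp mD) => //.
    by move=> _ [z [Dz _]] <-.
  by apply: measurable_funTS; exact: measurable_fst.
rewrite (_ : P = ((D `*` setT) `&` [set z | 0%:E <= z.2%:E]) `&`
   (((D `*` setT) `&` [set z | a z.1 <= z.2%:E]) `&`
   ((D `*` setT) `&` [set z | z.2%:E < b z.1]))).
  apply: measurableI; first exact: measurable_lee.
  apply: measurableI; first by apply: measurable_lee => //; exact: comp.
  by apply: measurable_lte => //; exact: comp.
apply/seteqP; split => -[x t]; rewrite /P /band /=.
  by move=> [t0 [Dx /andP[? ?]]]; rewrite lee_fin.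
by rewrite lee_fin => -[[_ t0] [[[Dx _] ?] [_ ?]]]; do 2 split => //; apply/andP.
Qed.

Hypothesis w0 : forall x, D x -> 0 <= w x.

Let F (z : T * measurableTypeR R) : \bar R := (w \_ D) z.1 * (\1_P z)%:E.

Let w'0 x : 0 <= (w \_ D) x.
Proof. by apply: erestrict_ge0. Qed.

Let F0 z : 0 <= F z.
Proof. by rewrite mule_ge0. Qed.

Let mF : measurable_fun setT F.
Proof.
apply: emeasurable_funM.
  apply: (measurableT_comp (f := w \_ D)) => //.
  by apply/(measurable_restrictT _ mD).
by apply/measurable_EFinP; exact: measurable_indic.
Qed.

Let FG t : fubini_G mu F t = if (0 <= t)%R then \int[mu]_(x in band t) w x else 0.
Proof.
rewrite /fubini_G /F; case: ifPn => t0.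
  rewrite [RHS]integral_mkcond; apply: eq_integral => x _.
  rewrite /patch/= indicE; case: ifPn => [xD|xD]; last first.
    rewrite mul0e ifF//; apply/negbTE; apply: contra xD.
    by rewrite !inE => -[].
  rewrite (_ : ((x, t) \in P) = (x \in band t)).
    by case: ifPn => _; rewrite ?mule1 ?mule0.
  by apply/idP/idP; rewrite !inE /P /= => // -[].
apply: integral0_eq => x _; rewrite indicE memNset ?mule0//.
by rewrite /P/= => -[]; rewrite (negbTE t0).
Qed.

Lemma measurable_integral_band :
  measurable_fun (`[0%R, +oo[ : set R) (fun t : R => \int[mu]_(x in band t) w x).
Proof.
apply: (eq_measurable_fun (fubini_G mu F)).
  by move=> t; rewrite inE/= in_itv/= andbT => t0; rewrite FG t0.
by apply: measurable_funTS; exact: measurable_fun_fubini_tonelli_G.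
Qed.

(** Since [0 <= a x], the constraint [0 <= t] cuts nothing off the interval from [a x] to [b x]. If
    [a x = +oo] the slice is empty and [b x - a x = -oo] by the convention on infinite sums, so the
    formula persists. *)
Let band_length (x : T) : D x -> 0 <= a x ->
  lebesgue_measure (xsection P x) = maxe 0 (b x - a x).
Proof.
move=> Dx a0.
have xP (I : set R) : (forall t, (0 <= t)%R /\ a x <= t%:E < b x <-> I t) ->
    xsection P x = I.
  move=> IE; apply/seteqP; split => t; rewrite /xsection /P /band /= inE/=.
    by move=> [? [_ ?]]; apply/IE.
  by move/IE => [? ?].
move: a0 xP; case: (a x) => [ax||]//; case: (b x) => [bx||]//.
- rewrite lee_fin => a0 xP; rewrite (xP `[ax, bx[%classic); last first.
    move=> t /=; rewrite in_itv/= lee_fin lte_fin; split; first by case.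
    by move=> /andP[at_ tb]; rewrite (le_trans a0 at_) at_ tb.
  rewrite lebesgue_measure_itv/= lte_fin; case: ltP => ab.
    by apply/esym/max_idPr; rewrite lee_fin subr_ge0 ltW.
  by apply/esym/max_idPl; rewrite lee_fin subr_le0.
- rewrite lee_fin => a0 xP; rewrite (xP `[ax, +oo[%classic); last first.
    move=> t /=; rewrite in_itv/= lee_fin ltry !andbT; split; first by case.
    by move=> at_; rewrite (le_trans a0 at_) at_.
  by rewrite lebesgue_measure_itv/= ltry; apply/esym/max_idPr; rewrite leey.
- move=> _ xP; rewrite (xP set0) ?measure0; last first.
    by move=> t; rewrite ltNge leNye andbF; split => // -[].
  by apply/esym/max_idPl; rewrite leNye.
- move=> _ xP; rewrite (xP set0) ?measure0; last first.
    by move=> t; split => // -[_ /andP[]]; rewrite leNgt ltry.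
  by apply/esym/max_idPl; rewrite leNye.
- move=> _ xP; rewrite (xP set0) ?measure0; last first.
    by move=> t; split => // -[_ /andP[]]; rewrite leNgt ltry.
  by apply/esym/max_idPl; rewrite leNye.
- move=> _ xP; rewrite (xP set0) ?measure0; last first.
    by move=> t; split => // -[_ /andP[]]; rewrite leNgt ltry.
  by apply/esym/max_idPl; rewrite leNye.
Qed.

(** Tonelli for [w] times the indicator of the region between the graphs of [a] and [b]. The sign of
    [a] is asked almost everywhere, as [a] will also be the given [f]. *)
Lemma weighted_layer_cake : {ae mu, forall x, D x -> 0 <= a x} ->
  \int[mu]_(x in D) (w x * maxe 0 (b x - a x)) =
  \int[lebesgue_measure]_(t in `[0%R, +oo[) \int[mu]_(x in band t) w x.
Proof.
move=> a0.
transitivity (\int[lebesgue_measure]_t fubini_G mu F t); last first.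
  rewrite [RHS]integral_mkcond; apply: eq_integral => t _.
  rewrite FG /patch/= mem_setE in_itv/= andbT.
  by case: ifPn.
rewrite -fubini_tonelli//.
transitivity (\int[mu]_(x in D) (w x * lebesgue_measure (xsection P x))).
  apply: ae_eq_integral => //.
  - apply: emeasurable_funM => //; apply: measurable_maxe => //.
    exact: emeasurable_funB.
  - apply: emeasurable_funM => //; apply: measurable_funTS.
    exact: measurable_fun_xsection.
  - by apply: filterS a0 => x a0 Dx; rewrite band_length// a0.
rewrite [LHS]integral_mkcond; apply: eq_integral => x _.
rewrite /fubini_F /F /= /patch; case: ifPn => xD; last first.
  by under eq_integral do rewrite mul0e; rewrite integral0.
rewrite ge0_integralZl//.
- congr (_ * _).
  rewrite -(setIT (xsection P x)) -integral_indic//; last exact: measurable_xsection.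
  apply: eq_integral => y _; congr EFin; rewrite !indicE; congr (nat_of_bool _)%:R.
  exact: mem_xsection.
- apply/measurable_EFinP; apply: (measurable_comp measurableT) => //.
- by apply: w0; rewrite inE in xD.
Qed.

End layer_cake.

(** Chebyshev's inequality. *)
Lemma integrable_superlevel_lty d (T : measurableType d) (R : realType)
    (mu : {measure set T -> \bar R}) (D : set T) (q : T -> R) (t : R) :
  measurable D -> mu.-integrable D (EFin \o q) -> (0 < t)%R ->
  mu [set x | D x /\ (t < q x)%R] < +oo.
Proof.
move=> mD /integrableP[mq iq] t0.
have mA : measurable (D `&` [set x | t%:E <= `|(EFin \o q) x|]).
  apply: measurable_lee => //; exact: measurableT_comp.
apply: (@le_lt_trans _ _ (mu (D `&` [set x | t%:E <= `|(EFin \o q) x|]))).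
  apply: le_measure; rewrite ?inE//.
    rewrite (_ : [set x | _] = D `&` [set x | (cst t%:E) x < (EFin \o q) x]).
      exact: measurable_lte.
    by apply/seteqP; split => x /=; rewrite lte_fin.
  move=> x [Ox tq]; split => //=; rewrite lee_fin (le_trans (ltW tq))//.
  exact: ler_norm.
have : t%:E * mu (D `&` [set x | t%:E <= `|(EFin \o q) x|]) < +oo.
  apply: le_lt_trans iq.
  exact: (@le_integral_comp_abse _ _ _ mu _ mD (EFin \o q) t id).
rewrite !ltey; apply: contra => /eqP ->.
by rewrite gt0_muley// lte_fin.
Qed.

Section monotone_ereal.
Context (R : realType).

Lemma nonincreasing_emeasurable (g : R -> \bar R) :
  {homo g : x y / (x <= y)%R >-> y <= x} -> measurable_fun setT g.
Proof.
move=> gm; apply: (measurability _ (ErealGenOInfty.measurableE R)).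
move=> _ [_ [r ->]] <-; rewrite setTI; apply: is_interval_measurable.
move=> x y /= + gy z /andP[_ zy] => _.
move: gy; rewrite !in_itv/= !andbT => gy; exact: lt_le_trans gy (gm _ _ zy).
Qed.

End monotone_ereal.

Section layer_cake_pos.
Context d (T : measurableType d) (R : realType).
Variables (mu : {sigma_finite_measure set T -> \bar R}) (D : set T).
Hypothesis mD : measurable D.

(** The null point [t = 0] is dropped: [{f > 0}] may have infinite measure, while the levels [t > 0]
    of an integrable function have finite measure. *)
Lemma layer_cake_pos (w a b : T -> \bar R) :
  measurable_fun D w -> measurable_fun D a -> measurable_fun D b ->
  (forall x, D x -> 0 <= w x) -> {ae mu, forall x, D x -> 0 <= a x} ->
  measurable_fun (`]0%R, +oo[ : set R) (fun t : R => \int[mu]_(x in band D a b t) w x) /\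
  \int[mu]_(x in D) (w x * maxe 0 (b x - a x)) =
  \int[lebesgue_measure]_(t in `]0%R, +oo[) \int[mu]_(x in band D a b t) w x.
Proof.
move=> mw ma mb w0 a0.
have mI := measurable_integral_band mu mD mw ma mb w0.
have mI' : measurable_fun (`]0%R, +oo[ : set R)
    (fun t : R => \int[mu]_(x in band D a b t) w x).
  by apply: measurable_funS mI => // t /=; rewrite !in_itv/= !andbT => /ltW.
by split => //; rewrite weighted_layer_cake// integral_itv_obnd_cbnd.
Qed.

Lemma norm_layer_cake (g : T -> R) : measurable_fun D g ->
  {ae mu, forall x, D x -> (0 <= g x)%R} ->
  \int[mu]_(x in D) `|(g x)%:E| =
  \int[lebesgue_measure]_(t in `]0%R, +oo[) mu [set x | D x /\ (t < g x)%R].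
Proof.
move=> mg g0; have mg' : measurable_fun D (EFin \o g) by exact/measurable_EFinP.
have mc c : measurable_fun D (cst c : T -> \bar R) by exact: measurable_cst.
have c0 : {ae mu, forall x, D x -> 0 <= (cst 0 : T -> \bar R) x} by exact: aeW.
have [_ h] := layer_cake_pos (mc 1) (mc 0) mg' (fun _ _ => lee01) c0.
transitivity (\int[mu]_(x in D) (cst 1 x * maxe 0 ((EFin \o g) x - cst 0 x))).
  apply: ae_eq_integral => //.
  - exact: measurableT_comp.
  - apply: emeasurable_funM => //; apply: measurable_maxe => //.
    exact: emeasurable_funB.
  - apply: filterS g0 => x gx Dx; rewrite /= mul1e sube0.
    by rewrite (max_idPr _) ?lee_fin ?ger0_norm// gx.
rewrite h; apply: eq_integral => t; rewrite inE/= in_itv/= andbT => t0.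
rewrite integral_cst ?mul1e//; last exact: measurable_band.
congr (mu _); apply/seteqP; split => x /= [Ox].
  by move=> /andP[_]; rewrite lte_fin.
by move=> tg; split => //; apply/andP; rewrite /= lte_fin tg lee_fin ltW.
Qed.

End layer_cake_pos.

(** * Spheres and balls for Lebesgue measure on R^d *)

Section lebesgue_Rd.
Variable R : realType.
Local Notation TT d := (d.-tuple (measurableTypeR R)).

Lemma leb_borel d (A : set (TT d)) : measurable A ->
  measurable (A : set (Rd R d)) /\ leb R d A = borel_leb R d A.
Proof.
move=> mA; split.
  by apply: sub_caratheodory; exact: sub_sigma_algebra.
exact: measurable_mu_extE.
Qed.

Definition sqnorm d (x : TT d) : R := (\sum_(i < d) tnth x i ^+ 2)%R.

Lemma measurable_sqnorm d : measurable_fun setT (@sqnorm d).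
Proof.
apply: measurable_sum => i; apply: measurable_funX; exact: measurable_tnth.
Qed.

Lemma sqnorm_tcons d x (y : TT d) : sqnorm (tcons (x, y)) = (x ^+ 2 + sqnorm y)%R.
Proof.
rewrite /sqnorm big_ord_recl; congr (_ + _)%R.
by apply: eq_bigr => i _; rewrite (tnth_nth 0%R) /= -tnth_nth.
Qed.

(** With the other coordinates [y] fixed, the first coordinate of a point of the sphere squares to
    [c - sqnorm y], so each slice has at most two points. In dimension 0 the measure is a Dirac mass
    and this fails for [c = 0]. *)
Lemma borel_leb_sphere d (c : R) : (0 < d)%N ->
  borel_leb R d [set x | sqnorm x = c] = 0.
Proof.
case: d => // d _.
rewrite /= /leb_cons /pushforward.
set X := _ @^-1` _.
have mX : measurable X.
  rewrite -[X]setTI; apply: (measurable_tcons) => //.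
  by rewrite -[X in measurable X]setTI; exact: (measurable_sqnorm measurableT (measurable_set1 c)).
(* Uniqueness of the product measure gives the other order of integration, with slices at fixed
   [y]. *)
rewrite (product_measure_unique (m' := lebesgue_measure \x^ borel_leb R d))//; last first.
  by move=> A B mA mB; exact: product_measure2E.
rewrite /product_measure2; apply: integral0_eq => y _ /=.
pose r := Num.sqrt (c - sqnorm y)%R.
apply: countable_lebesgue_measure0; apply: finite_set_countable.
apply: (@sub_finite_set _ _ [set r; (- r)%R]) => //.
move=> x; rewrite /ysection /= inE /X /= sqnorm_tcons => xc.
have x2 : (x ^+ 2 = r ^+ 2)%R.
  by rewrite sqr_sqrtr -xc ?addrK// sqr_ge0.
by move/eqP : x2; rewrite eqf_sqr => /orP[] /eqP; [left|right].
Qed.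

Definition cube d (r : R) : set (TT d) :=
  [set x | forall i, (- r <= tnth x i <= r)%R].

Lemma measurable_cube d r : measurable (@cube d r).
Proof.
rewrite (_ : cube _ = \big[setI/setT]_(i < d) ((fun x : TT d => tnth x i) @^-1` `[(- r)%R, r]%classic)).
  apply: bigsetI_measurable => i _; rewrite -[X in measurable X]setTI.
  exact: measurable_tnth.
apply/seteqP; split => [x h|x].
  by apply: (@big_ind _ (fun A : set _ => A x)) => // i _; rewrite /= in_itv; exact: h.
by move=> + i; rewrite (bigD1 i)//= => -[]; rewrite in_itv.
Qed.

Lemma borel_leb_cube d (r : R) : (borel_leb R d (cube r) < +oo)%E.
Proof.
elim: d => [|d IH].
  by rewrite /= diracE ltry.
rewrite /= /leb_cons /pushforward.
rewrite (_ : _ @^-1` _ = `[(- r)%R, r]%classic `*` cube r).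
  rewrite product_measure1E//; last exact: measurable_cube.
  apply: lte_mul_pinfty => //.
  by rewrite /= lebesgue_measure_itv/=; case: ifP.
apply/seteqP; split => -[x y]; rewrite /cube /=.
  move=> h; split; first by have := h ord0; rewrite in_itv.
  by move=> i; have := h (lift ord0 i); rewrite (tnth_nth 0%R) /= -tnth_nth.
move=> [xr h] i; case: (unliftP ord0 i) => [j|] ->.
  by rewrite (tnth_nth 0%R) /= -tnth_nth.
by rewrite in_itv in xr.
Qed.

Lemma measurable_enorm d : measurable_fun setT (@enorm R d).
Proof.
have : measurable_fun setT (fun x : TT d => Num.sqrt (sqnorm x)).
  have ms : measurable_fun setT (Num.sqrt : R -> R).
    by apply: continuous_measurable_fun; exact: sqrt_continuous.
  exact: measurableT_comp ms (@measurable_sqnorm d).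
move=> h _ B mB; apply: (leb_borel _).1; exact: h.
Qed.

Lemma leb_sphere d r : (0 < d)%N -> leb R d [set x | enorm x = r] = 0.
Proof.
move=> d0.
have mS : measurable [set x : TT d | sqnorm x = (r ^+ 2)%R].
  by rewrite -[X in measurable X]setTI; exact: (measurable_sqnorm measurableT (measurable_set1 _)).
apply: (@subset_measure0 _ _ _ _ _ ([set x : TT d | sqnorm x = (r ^+ 2)%R] : set (Rd R d))).
- rewrite -[X in measurable X]setTI; exact: (measurable_enorm measurableT (measurable_set1 _)).
- exact: (leb_borel mS).1.
- move=> x /= <-; rewrite sqr_sqrtr//.
  by apply: sumr_ge0 => i _; exact: sqr_ge0.
- exact: etrans (leb_borel mS).2 (borel_leb_sphere _ d0).
Qed.

(** The ball lies in the cube of half-side [r], whose measure is finite by induction on the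
    dimension. *)
Lemma leb_ball d r : leb R d [set x | (enorm x < r)%R] < +oo.
Proof.
have [mC CE] := leb_borel (@measurable_cube d r).
apply: (@le_lt_trans _ _ (leb R d (cube r))); last first.
  by move: (borel_leb_cube d r); rewrite -CE.
apply: le_measure; rewrite ?inE//.
  rewrite -[X in measurable X]setTI (_ : [set _ | _] = enorm (d := d) @^-1` `]-oo, r[%classic).
    exact: measurable_enorm.
  by apply/seteqP; split => x /=; rewrite in_itv.
move=> x /= xr i; rewrite -ler_norml; apply: le_trans (ltW xr).
rewrite -sqrtr_sqr; apply: ler_wsqrtr.
rewrite (bigD1 i)//= lerDl; apply: sumr_ge0 => j _; exact: sqr_ge0.
Qed.

End lebesgue_Rd.

(** * The distribution function of a weight *)

Section weight_distribution.
Context {R : realType} {d : nat}.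
Local Notation mu := (leb R d).
Variables (Om : set (Rd R d)) (w : Rd R d -> R).
Hypotheses (mOm : measurable Om) (mw : measurable_fun Om w).
Local Notation a := (asigma Om w).

Lemma measurable_weight_preimage (B : set R) : measurable B ->
  measurable [set x | Om x /\ B (w x)].
Proof. by move=> mB; exact: mw. Qed.

Lemma measurable_weight_lt e : measurable [set x | Om x /\ (w x < e)%R].
Proof.
rewrite (_ : [set x | _] = [set x | Om x /\ `]-oo, e[%classic (w x)]).
  exact: measurable_weight_preimage.
by apply/seteqP; split => x /=; rewrite in_itv.
Qed.

Lemma asigma_homo : {homo a : x y / (x <= y)%R >-> x <= y}.
Proof.
move=> x y xy; apply: le_measure; rewrite ?inE; [exact: measurable_weight_lt..|].
by move=> t [Ot wx]; split => //; exact: lt_le_trans wx xy.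
Qed.

Lemma asigma_leT e : a e <= mu Om.
Proof. by apply: le_measure; rewrite ?inE//; [exact: measurable_weight_lt|move=> x []]. Qed.

(** Continuity from below along [{w < c - 1 / (n + 1)}]. *)
Lemma asigma_left c (y : \bar R) : (forall e, (e < c)%R -> a e <= y) -> a c <= y.
Proof.
move=> ay; pose F n := [set x | Om x /\ (w x < c - n.+1%:R^-1)%R].
have mF n : measurable (F n) by exact: measurable_weight_lt.
have FE : [set x | Om x /\ (w x < c)%R] = \bigcup_n F n.
  apply/seteqP; split => x /=.
    move=> [Ox /ltr_add_invr[n wn]]; exists n => //; split => //.
    by rewrite ltrBrDr.
  move=> [n _ [Ox wn]]; split => //; apply: lt_trans wn _.
  by rewrite ltrBlDr ltrDl invr_gt0.
have ndF : {homo F : n m / (n <= m)%N >-> (n <= m)%O}.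
  move=> n m nm; apply/subsetPset => x [Ox wx]; split => //.
  by apply: lt_le_trans wx _; rewrite lerD2l lerN2 lef_pV2 ?posrE// ler_nat ltnS.
have cF := @nondecreasing_cvg_mu _ _ _ mu _ mF (bigcup_measurable (fun k _ => mF k)) ndF.
rewrite /asigma FE -(cvg_lim _ cF)//; apply: lime_le; first by apply/cvg_ex; eexists; exact: cF.
by apply: nearW => n /=; apply: ay; rewrite ltrBlDr ltrDl invr_gt0.
Qed.

(** Continuity from above along [{w < c + (e' - c) / (n + 1)}]; the first of these sets is
    [{w < e'}], whose measure is finite. *)
Lemma asigma_right c e' (y : \bar R) : (c < e')%R -> a e' < +oo ->
  (forall e, (c < e)%R -> y <= a e) -> y <= mu [set x | Om x /\ (w x <= c)%R].
Proof.
move=> ce' ae' ya.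
pose F n := [set x | Om x /\ (w x < c + (e' - c) / n.+1%:R)%R].
have mF n : measurable (F n) by exact: measurable_weight_lt.
have ec0 : (0 < e' - c)%R by rewrite subr_gt0.
have FE : [set x | Om x /\ (w x <= c)%R] = \bigcap_n F n.
  apply/seteqP; split => x /=.
    move=> [Ox wx] n _; split => //; apply: le_lt_trans wx _.
    by rewrite ltrDl divr_gt0.
  move=> Fx; split; first by have [] := Fx 0%N I.
  rewrite leNgt; apply/negP => cw.
  have : (0 < (w x - c) / (e' - c))%R by rewrite divr_gt0// subr_gt0.
  move=> /ltr_add_invr[n]; rewrite add0r => wn.
  have [_] := Fx n I; apply/negP; rewrite -leNgt -lerBrDl.
  by rewrite mulrC -ler_pdivlMr// ltW.
have niF : {homo F : n m / (n <= m)%N >-> (m <= n)%O}.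
  move=> n m nm; apply/subsetPset => x [Ox wx]; split => //.
  apply: lt_le_trans wx _; rewrite lerD2l ler_pM2l//.
  by rewrite lef_pV2 ?posrE// ler_nat ltnS.
have F0 : mu (F 0%N) < +oo by rewrite /F divr1 subrKC.
have cF := @nonincreasing_cvg_mu _ _ _ mu _ F0 mF (bigcap_measurableType (fun k _ => mF k)) niF.
rewrite FE -(cvg_lim _ cF)//; apply: lime_ge; first by apply/cvg_ex; eexists; exact: cF.
by apply: nearW => n /=; apply: ya; rewrite ltrDl divr_gt0.
Qed.

Lemma asigma_top (y : \bar R) : (forall e, a e <= y) -> mu Om <= y.
Proof.
move=> ay; pose F n := [set x | Om x /\ (w x < n%:R)%R].
have mF n : measurable (F n) by exact: measurable_weight_lt.
have FE : Om = \bigcup_n F n.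
  apply/seteqP; split => x /=.
    move=> Ox; exists (Num.truncn (w x)).+1 => //; split => //.
    exact: truncnS_gt.
  by move=> [n _ []].
have ndF : {homo F : n m / (n <= m)%N >-> (n <= m)%O}.
  move=> n m nm; apply/subsetPset => x [Ox wx]; split => //.
  by apply: lt_le_trans wx _; rewrite ler_nat.
have cF := @nondecreasing_cvg_mu _ _ _ mu _ mF (bigcup_measurable (fun k _ => mF k)) ndF.
rewrite [in leLHS]FE -(cvg_lim _ cF)//; apply: lime_le; first by apply/cvg_ex; eexists; exact: cF.
by apply: nearW => n /=; exact: ay.
Qed.

Lemma asigma_bottom e' (y : \bar R) : a e' < +oo -> (forall e, y <= a e) -> y <= 0.
Proof.
move=> ae' ya; pose F n := [set x | Om x /\ (w x < e' - n%:R)%R].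
have mF n : measurable (F n) by exact: measurable_weight_lt.
have FE : set0 = \bigcap_n F n.
  apply/seteqP; split => x //= Fx.
  have [_] := Fx (Num.truncn (e' - w x)).+1 I.
  by apply/negP; rewrite -leNgt lerBlDr -lerBlDl ltW// truncnS_gt.
have niF : {homo F : n m / (n <= m)%N >-> (m <= n)%O}.
  move=> n m nm; apply/subsetPset => x [Ox wx]; split => //.
  by apply: lt_le_trans wx _; rewrite lerD2l lerN2 ler_nat.
have F0 : mu (F 0%N) < +oo by rewrite /F subr0.
have cF := @nonincreasing_cvg_mu _ _ _ mu _ F0 mF (bigcap_measurableType (fun k _ => mF k)) niF.
rewrite (_ : 0 = mu (\bigcap_n F n)); last by rewrite -FE measure0.
rewrite -(cvg_lim _ cF)//; apply: lime_ge; first by apply/cvg_ex; eexists; exact: cF.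
by apply: nearW => n /=; exact: ya.
Qed.

Lemma measurable_Bdom m : measurable (Bdom Om w m).
Proof.
apply: (@measurable_weight_preimage [set e | a e < m%:E]).
apply: is_interval_measurable => x y /= ax ay z /andP[_ zy].
exact: le_lt_trans (asigma_homo zy) ay.
Qed.

Lemma Bdom_homo m m' : (m <= m')%R -> Bdom Om w m `<=` Bdom Om w m'.
Proof. by move=> mm' x [Ox ax]; split => //; apply: lt_le_trans ax _; rewrite lee_fin. Qed.

Lemma Bdom0 m : (m <= 0)%R -> Bdom Om w m = set0.
Proof.
move=> m0; apply/seteqP; split => // x [_]; apply/negP; rewrite -leNgt.
by apply: le_trans (measure_ge0 _ _); rewrite lee_fin.
Qed.

(* The distribution function of [w] is continuous and exhausts [mu Om], so
   [a \o w] is uniformly distributed on [0, mu Om[. *)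
Hypothesis wlevel : forall e, a e < mu Om -> mu [set x | Om x /\ w x = e] = 0.
Hypothesis wright : forall e, a e < mu Om -> exists2 e', (e < e')%R & a e' < +oo.
Hypothesis wleft : exists e, a e < +oo.

Lemma measure_Bdom m : (0 <= m)%R -> m%:E <= mu Om -> mu (Bdom Om w m) = m%:E.
Proof.
rewrite le_eqVlt => /orP[/eqP <- _|m0 mM]; first by rewrite Bdom0// measure0.
pose S := [set e | a e < m%:E].
have S0 : S !=set0.
  apply: contrapT => S0; have [e ae] := wleft.
  have : m%:E <= 0.
    apply: (asigma_bottom ae) => e1; rewrite leNgt; apply/negP => ?; apply: S0.
    by exists e1.
  by rewrite lee_fin leNgt m0.
(* If [S] is unbounded, then [a < m] everywhere, [Bdom m] is all of [Om], and [m = mu Om]. *)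
have [ubS|nubS] := pselect (has_ubound S); last first.
  have aS e : a e < m%:E.
    apply: contrapT => /negP; rewrite -leNgt => me; apply: nubS; exists e => x /= ax.
    rewrite leNgt; apply/negP => ex.
    by move: (le_lt_trans (le_trans me (asigma_homo (ltW ex))) ax); rewrite ltxx.
  rewrite (_ : Bdom _ _ _ = Om); last by apply/seteqP; split => x // [].
  by apply/eqP; rewrite eq_le mM andbT; apply: asigma_top => e; exact: ltW.
(* [c] is the level at which [a] reaches [m]: left continuity gives [a c <= m], and the right limit
   gives equality because [{w = c}] is null. Then [Bdom m] is [{w < c}]. *)
pose c := sup S.
have lt_cS e : (e < c)%R -> a e < m%:E.
  move=> /(sup_gt S0)[x Sx ex]; exact: le_lt_trans (asigma_homo (ltW ex)) Sx.
have gt_cS e : (c < e)%R -> m%:E <= a e.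
  move=> ce; rewrite leNgt; apply/negP => Se.
  by move: ce; rewrite ltNge => /negP; apply; exact: ub_le_sup.
have acm : a c <= m%:E by apply: asigma_left => e /lt_cS/ltW.
have ac : a c = m%:E.
  apply/eqP; rewrite eq_le acm leNgt; apply/negP => acltm.
  have acM := lt_le_trans acltm mM.
  have [e' ce' ae'] := wright acM.
  have := asigma_right ce' ae' gt_cS.
  rewrite (_ : [set x | _] = [set x | Om x /\ (w x < c)%R] `|` [set x | Om x /\ w x = c]); last first.
    apply/seteqP; split => x /=; rewrite le_eqVlt.
      by move=> [Ox /predU1P[wc|wc]]; [right|left].
    by move=> [[Ox ->]|[Ox ->]]; rewrite ?orbT ?eqxx.
  have ml : measurable [set x | Om x /\ w x = c].
    exact: (measurable_weight_preimage (measurable_set1 c)).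
  rewrite measureU//; [|exact: measurable_weight_lt|]; last first.
    by apply/seteqP; split => x //= [[_ +] [_ wc]]; rewrite wc ltxx.
  by rewrite [X in _ <= _ + X]wlevel// adde0 leNgt acltm.
rewrite -ac; congr (mu _); apply/seteqP; split => x [Ox h]; split => //.
  by rewrite ltNge; apply/negP => cw; move: h; rewrite ltNge -ac (asigma_homo cw).
exact: lt_cS.
Qed.

End weight_distribution.

(** * Rearrangements and their superlevel sets *)

Section rearrangement.
Context {R : realType} {d : nat}.
Local Notation mu := (leb R d).
Variable Om : set (Rd R d).
Hypothesis mOm : measurable Om.

Section one_function.
Variable q : Rd R d -> R.
Hypothesis mq : measurable_fun Om q.

(** Reflection turns superlevels into sublevels, so that the continuity results for [asigma]
    transfer to [mudist]. *)
Lemma mudistE t : mudist Om q t = asigma Om (fun x => - q x)%R (- t)%R.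
Proof. by rewrite /mudist /asigma; congr (mu _); apply/seteqP; split => x /=; rewrite ltrN2. Qed.

Let mNq : measurable_fun Om (fun x => - q x)%R.
Proof. exact: measurable_funN. Qed.

Lemma measurable_superlevel t : measurable [set x | Om x /\ (t < q x)%R].
Proof.
rewrite (_ : [set x | _] = [set x | Om x /\ (- q x < - t)%R]).
  exact: measurable_weight_lt.
by apply/seteqP; split => x /=; rewrite ltrN2.
Qed.

Lemma mudist_homo : {homo mudist Om q : x y / (x <= y)%R >-> y <= x}.
Proof. by move=> x y xy; rewrite !mudistE; apply: asigma_homo => //; rewrite lerN2. Qed.

Lemma mudist_le t : mudist Om q t <= mu Om.
Proof. by rewrite mudistE asigma_leT. Qed.

Lemma mudist_ge0 t : 0 <= mudist Om q t. Proof. exact: measure_ge0. Qed.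

Lemma mudist_right t (s : \bar R) : s < mudist Om q t ->
  exists2 t', (t < t')%R & s < mudist Om q t'.
Proof.
move=> st; apply: contrapT => nt; move: st; rewrite ltNge => /negP; apply.
rewrite mudistE; apply: asigma_left => // e et; rewrite leNgt; apply/negP => se.
apply: nt; exists (- e)%R; first by rewrite ltrNr.
by rewrite mudistE opprK.
Qed.

(** The Galois connection between [qsharp] and [mudist], through which superlevel sets of a
    rearrangement become sublevel sets of its weight. Right continuity of [mudist] supplies a
    [t' > t] that keeps the inequality strict. *)
Lemma lt_qsharp t (s : \bar R) : (0 <= t)%R ->
  (t%:E < qsharp Om q s) = (s < mudist Om q t).
Proof.
move=> t0; apply/idP/idP; last first.
  move=> /mudist_right[t' tt' st'].
  apply: (@lt_le_trans _ _ t'%:E); first by rewrite lte_fin.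
  apply: le_ereal_inf_tmp => _ [r [r0 rs] <-]; rewrite lee_fin leNgt.
  apply/negP => /ltW/mudist_homo /(le_trans)/(_ rs); by rewrite leNgt st'.
apply: contraTT; rewrite -!leNgt => ts.
by apply: ereal_inf_lbound; exists t.
Qed.

Lemma qsharp_ge0 (s : \bar R) : 0 <= qsharp Om q s.
Proof. by apply: le_ereal_inf_tmp => _ [r [r0 rs] <-]; rewrite lee_fin. Qed.

Lemma mudist_lty t : mu.-integrable Om (EFin \o q) -> (0 < t)%R ->
  mudist Om q t < +oo.
Proof. exact: integrable_superlevel_lty. Qed.

(** Where [sigma] reaches [emax] the rearrangement is 0 by definition, and [asigma (sigma x)] is at
    least [mu Om], hence at least [mudist q t]: both sides are false there. *)
Lemma lt_qsigma sigma (msigma : measurable_fun Om sigma) t x :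
  (forall x, Om x -> emax Om sigma <= (sigma x)%:E -> mu Om <= asigma Om sigma (sigma x)) ->
  (0 <= t)%R -> mudist Om q t < +oo -> Om x ->
  t%:E < qsigma Om sigma q x <-> Bdom Om sigma (fine (mudist Om q t)) x.
Proof.
move=> emaxM t0 qt Ox; rewrite /qsigma /Bdom /= fineK ?ge0_fin_numE//.
case: ifPn => [_|]; first by rewrite lt_qsharp//; split => // -[].
rewrite -leNgt => se; split; first by rewrite lte_fin ltNge t0.
by move=> [_]; rewrite ltNge (le_trans (mudist_le _) (emaxM _ Ox se)).
Qed.

Lemma qsigma_ge0 sigma x : 0 <= qsigma Om sigma q x.
Proof. by rewrite /qsigma; case: ifP => // _; exact: qsharp_ge0. Qed.

End one_function.

(** Lets the Euclidean norm act as a weight: its level sets are spheres, which are null, and balls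
    have finite measure. *)
Lemma Bdom_enorm_measure m : (0 < d)%N -> (0 <= m)%R -> m%:E <= mu Om ->
  mu (Bdom Om (@enorm R d) m) = m%:E.
Proof.
move=> d0; have me : measurable_fun Om (@enorm R d).
  by apply: measurable_funTS; exact: measurable_enorm.
have fin e : asigma Om (@enorm R d) e < +oo.
  apply: le_lt_trans (@leb_ball R d e); apply: le_measure; rewrite ?inE.
  - exact: measurable_weight_lt.
  - rewrite (_ : [set x | _] = [set x | setT x /\ (enorm x < e)%R]).
      exact: (measurable_weight_lt measurableT (@measurable_enorm R d)).
    by apply/seteqP; split => x //= [].
  - by move=> x [].
apply: measure_Bdom => //.
- move=> e _; apply: (@subset_measure0 _ _ _ _ _ [set x | enorm x = e]) => //.
  + exact: (measurable_weight_preimage mOm me (measurable_set1 e)).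
  + rewrite (_ : [set x | _] = [set x | setT x /\ [set e] (enorm x)]).
      exact: (measurable_weight_preimage measurableT (@measurable_enorm R d) (measurable_set1 e)).
    by apply/seteqP; split => x //= [].
  + by move=> x [].
  + exact: leb_sphere.
- by move=> e _; exists (e + 1)%R; rewrite ?ltrDl.
- by exists 0%R.
Qed.

(** The superlevel sets of both rearrangements are sublevel sets of the norm, hence nested, so the
    measure of their difference is the positive part of the difference of their measures. *)
Lemma betaE (f q : Rd R d -> R) t : (0 < d)%N ->
  measurable_fun Om f -> measurable_fun Om q -> (0 <= t)%R ->
  mudist Om f t < +oo -> mudist Om q t < +oo ->
  beta Om (qstar Om f) (qstar Om q) t =
  (Num.max 0 (fine (mudist Om q t) - fine (mudist Om f t)))%:E.
Proof.
move=> d0 mf mq t0 ft qt.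
have me : measurable_fun Om (@enorm R d).
  by apply: measurable_funTS; exact: measurable_enorm.
have star (g : Rd R d -> R) (mg : measurable_fun Om g) x : mudist Om g t < +oo -> Om x ->
    (t%:E < qstar Om g x) <-> Bdom Om (@enorm R d) (fine (mudist Om g t)) x.
  move=> gt Ox; rewrite /qstar lt_qsharp// /Bdom /= fineK ?ge0_fin_numE ?mudist_ge0//.
  rewrite (_ : mu (_ `&` _) = asigma Om enorm (enorm x)); first by split => // -[].
  by congr (mu _); apply/seteqP; split => y [].
rewrite /beta (_ : [set x | _] = Bdom Om (@enorm R d) (fine (mudist Om q t)) `\`
    Bdom Om (@enorm R d) (fine (mudist Om f t))); last first.
  apply/seteqP; split => x /=.
    move=> [Ox [fx qx]]; split; first exact/star.
    by move/(star _ mf _ ft Ox); rewrite ltNge fx.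
  move=> [xq xf]; have Ox : Om x by case: xq.
  split => //; split; last exact/star.
  by rewrite leNgt; apply/negP => /(star _ mf _ ft Ox).
have fq_ge0 (g : Rd R d -> R) : (0 <= fine (mudist Om g t))%R by rewrite fine_ge0// mudist_ge0.
have fqM (g : Rd R d -> R) : measurable_fun Om g -> mudist Om g t < +oo ->
    mu (Bdom Om (@enorm R d) (fine (mudist Om g t))) = (fine (mudist Om g t))%:E.
  move=> mg gt; apply: Bdom_enorm_measure => //.
  by rewrite fineK ?ge0_fin_numE ?mudist_ge0// mudist_le.
have [qf|fq] := leP (fine (mudist Om q t)) (fine (mudist Om f t)).
  rewrite (_ : _ `\` _ = set0); last by apply/seteqP; split => x // [] /(Bdom_homo qf).
  by rewrite measure0; congr EFin; apply/esym/max_idPl; rewrite subr_le0.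
have qty : mu (Bdom Om (@enorm R d) (fine (mudist Om q t))) < +oo by rewrite fqM// ltry.
have me' m : measurable (Bdom Om (@enorm R d) m) by exact: measurable_Bdom.
rewrite [LHS](measureD (me' _) (me' _) qty).
rewrite setIidr; last exact/Bdom_homo/ltW.
transitivity ((fine (mudist Om q t))%:E - (fine (mudist Om f t))%:E).
  by congr (_ - _); exact: fqM.
by congr EFin; apply/esym/max_idPr; rewrite subr_ge0 ltW.
Qed.

End rearrangement.

(** * Consequences of admissibility *)

Section admissible_weight.
Context {R : realType} {d : nat}.
Local Notation mu := (leb R d).
Variables (Om : set (Rd R d)) (sigma : Rd R d -> R).
Hypotheses (mOm : measurable Om) (msigma : measurable_fun Om sigma).
Hypothesis adm : admissible sigma mOm.
Local Notation a := (asigma Om sigma).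
Local Notation emax := (emax Om sigma).
Local Notation b := (bsigma Om sigma).
Local Notation Bd := (Bdom Om sigma).

(** If [emax] were a real [e] with [a e < mu Om], the limit [mu Om] of [a] from the left at [emax]
    would force values above [a e] just before [e], against monotonicity. *)
Lemma lt_emaxP (e : R) : (e%:E < emax) = (a e < mu Om).
Proof.
apply/idP/idP.
  move=> /ereal_sup_gt[_ [e' ae' <-]]; rewrite lte_fin => ee'.
  exact: le_lt_trans (asigma_homo mOm msigma (ltW ee')) ae'.
move=> ae; have : e%:E <= emax by apply: ereal_sup_ubound; exists e.
rewrite le_eqVlt => /predU1P[eE|//]; exfalso.
have [+ _ _ _] := adm; have := adm_lim adm; rewrite -eE => cv _.
have : nbhs (mu Om) [set y | a e < y].
  by apply: open_nbhs_nbhs; split => //; exact: open_ereal_gt_ereal.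
move=> /cv; rewrite /fmap /within /= => -[r /= r0 hr].
have := hr (e - r / 2)%R.
rewrite /ball /= opprB addrC subrK ger0_norm ?divr_ge0 ?ltW//.
rewrite gtr_pMr// invf_lt1// ltr1n => /(_ isT).
rewrite lte_fin ltrBlDr ltrDl divr_gt0// => /(_ isT).
by rewrite ltNge asigma_homo// lerBlDr lerDl divr_ge0// ltW.
Qed.

Lemma measure_Om_gt0 : 0 < mu Om.
Proof. by have [[e ae] _ _ _] := adm; apply: le_lt_trans ae; exact: measure_ge0. Qed.

Lemma measure_Bdom_adm m : (0 <= m)%R -> m%:E <= mu Om -> mu (Bd m) = m%:E.
Proof.
apply: measure_Bdom => //.
- by move=> e; rewrite -lt_emaxP => /(adm_level adm).
- move=> e; rewrite -lt_emaxP => /ereal_sup_gt[_ [e' ae' <-]]; rewrite lte_fin => ee'.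
  by exists e' => //; exact: lt_le_trans ae' (leey _).
- by have [[e ae] _ _ _] := adm; exists e; exact: lt_le_trans ae (leey _).
Qed.

Lemma Bdom_eqT m : mu Om < m%:E -> Bd m = Om.
Proof.
move=> Mm; apply/seteqP; split => [x []//|x Ox]; split => //.
exact: le_lt_trans (asigma_leT mOm msigma _) Mm.
Qed.

Lemma measure_Bdom_min m : (0 <= m)%R -> mu (Bd m) = mine m%:E (mu Om).
Proof.
move=> m0; case: (leP m%:E) => mM; first exact: measure_Bdom_adm.
by rewrite Bdom_eqT.
Qed.

Lemma bsigma_homo (m m' : \bar R) : m <= m' -> b m <= b m'.
Proof.
move=> mm'; apply: le_ereal_sup => _ [t [te tm] <-]; exists t => //; split => //.
exact: le_trans tm mm'.
Qed.

(** [a] tends to 0 at [-oo], so some level has distribution below [m]; the minimum with [e0] keeps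
    it below [emax]. *)
Lemma bsigma_gtNy m : (0 < m)%R -> -oo < b m%:E.
Proof.
move=> m0; have [[e0 ae0] _ _ _] := adm.
have [e ae] : exists e, a e < m%:E.
  apply: contrapT => ne; suff : m%:E <= 0 by rewrite lee_fin leNgt m0.
  apply: (asigma_bottom mOm msigma (lt_le_trans ae0 (leey _))) => e.
  by rewrite leNgt; apply/negP => ?; apply: ne; exists e.
apply: (@lt_le_trans _ _ (Num.min e e0)%:E); first exact: ltNyr.
apply: ereal_sup_ubound; exists (Num.min e e0) => //; split.
  by rewrite lt_emaxP; apply: le_lt_trans ae0; apply: asigma_homo => //; rewrite ge_min lexx orbT.
by apply: le_trans (ltW ae); apply: asigma_homo => //; rewrite ge_min lexx.
Qed.

(** [a] tends to [mu Om] at [+oo], so it exceeds [m] at some real [e], which bounds all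
    competitors. *)
Lemma bsigma_lty (m : \bar R) : m < mu Om -> b m < +oo.
Proof.
move=> mM; have [e ae] : exists e, m < a e.
  apply: contrapT => ne; move: mM; rewrite ltNge => /negP; apply.
  apply: (asigma_top mOm msigma) => e; rewrite leNgt; apply/negP => ?.
  by apply: ne; exists e.
apply: (@le_lt_trans _ _ e%:E); last exact: ltry.
apply: ge_ereal_sup => _ [t [_ am] <-]; rewrite lee_fin leNgt; apply/negP => et.
by move: (lt_le_trans ae (asigma_homo mOm msigma (ltW et))); rewrite ltNge am.
Qed.

Lemma bsigma_emax (m : \bar R) : mu Om <= m -> b m = emax.
Proof.
move=> Mm; congr ereal_sup; apply/seteqP; split => _ [t h <-]; exists t => //.
  by rewrite /= -lt_emaxP; case: h.
by move: h => /= h; split; rewrite ?lt_emaxP//; apply: le_trans (ltW h) Mm.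
Qed.

Lemma sigma_le_bsigma m x : m%:E <= mu Om -> Bd m x -> (sigma x)%:E <= b m%:E.
Proof.
move=> mM [Ox ax]; apply: ereal_sup_ubound; exists (sigma x) => //; split; last exact: ltW.
by rewrite lt_emaxP; exact: lt_le_trans ax mM.
Qed.

Lemma emax_measure x : Om x -> emax <= (sigma x)%:E -> mu Om <= a (sigma x).
Proof. by move=> _; rewrite !leNgt lt_emaxP. Qed.

(** Beyond [mu Om] the set [Bd m] is all of [Om] and may contain points with [sigma x >= emax].
    These lie outside [Bd (mu Om)], which already has full measure. *)
Lemma Bdom_sigma_le m : (0 <= m)%R ->
  {ae mu, forall x, Bd m x -> (sigma x)%:E <= b m%:E}.
Proof.
move=> m0; have [mM|Mm] := leP m%:E (mu Om).
  by apply: aeW => x; exact: sigma_le_bsigma.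
have Mfin : mu Om \is a fin_num by rewrite ge0_fin_numE ?measure_ge0// (lt_le_trans Mm)// leey.
exists (Om `\` Bd (fine (mu Om))); split.
- by apply: measurableD => //; exact: measurable_Bdom.
- rewrite [LHS]measureD//; [|exact: measurable_Bdom|by rewrite ltey_eq Mfin].
  rewrite setIidr; last by move=> x [].
  transitivity (mu Om - mu Om); last by rewrite subee.
  congr (_ - _); rewrite -[RHS]fineK//; apply: measure_Bdom_adm.
    by rewrite fine_ge0// measure_ge0.
  by rewrite fineK.
- move=> x /= h; apply: contrapT => nx; apply: h => -[Ox _].
  have [xB|//] := pselect (Bd (fine (mu Om)) x); last by move=> xB; exfalso; apply: nx; split.
  apply: (@le_trans _ _ (b (fine (mu Om))%:E)).
    by apply: sigma_le_bsigma => //; rewrite fineK.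
  by apply: bsigma_homo; rewrite fineK// ltW.
Qed.

(** For [m'] slightly above [m] the set lies in the difference of [Bd m'] and [Bd m], of measure
    [m' - m]. *)
Lemma asigma_level_null m : (0 <= m)%R -> m%:E < mu Om ->
  mu [set x | Om x /\ a (sigma x) = m%:E] = 0.
Proof.
move=> m0 mM; apply/eqP; rewrite eq_le measure_ge0 andbT.
apply/lee_addgt0Pr => e e0; rewrite add0e.
have [m' [mm' m'e m'M]] : exists m', [/\ (m < m')%R, (m' <= m + e)%R & m'%:E <= mu Om].
  have [meM|Mme] := leP (m + e)%:E (mu Om); first by exists (m + e)%R; rewrite ltrDl.
  have Mfin : mu Om \is a fin_num by rewrite ge0_fin_numE ?measure_ge0// (lt_le_trans Mme)// leey.
  exists (fine (mu Om)); split; rewrite ?fineK//.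
    by rewrite -lte_fin fineK.
  by rewrite -lee_fin fineK// ltW.
have mB k : measurable (Bd k) by exact: measurable_Bdom.
have m'0 : (0 <= m')%R by rewrite (le_trans m0)// ltW.
apply: (@le_trans _ _ (mu (Bd m' `\` Bd m))).
  apply: le_measure; rewrite ?inE; last first.
  - by move=> x [Ox ax]; split; [split => //; rewrite ax lte_fin|move=> []; rewrite ax ltxx].
  - exact: measurableD.
  - apply: (measurable_weight_preimage mOm msigma (B := [set e | a e = m%:E])).
    apply: is_interval_measurable => x y /= ax ay z /andP[xz zy].
    by apply/eqP; rewrite eq_le -{1}ay -ax !asigma_homo.
have fB : mu (Bd m') < +oo by rewrite measure_Bdom_adm// ltry.
rewrite [leLHS](measureD (mB _) (mB _) fB).
rewrite setIidr; last exact/Bdom_homo/ltW.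
apply: (@le_trans _ _ (m'%:E - m%:E)); last by rewrite -EFinB lee_fin lerBlDl.
by rewrite le_eqVlt; apply/orP; left; apply/eqP; congr (_ - _); apply: measure_Bdom_adm => //; exact: ltW.
Qed.

(** Outside [Bd m] one has [a (sigma x) >= m]. If also [sigma x < b m], monotonicity forces
    [a (sigma x) = m]: the exceptional points sit on a plateau of [a], which is null. *)
Lemma Bdom_sigma_ge m : (0 <= m)%R ->
  {ae mu, forall x, Om x -> ~ Bd m x -> b m%:E <= (sigma x)%:E}.
Proof.
move=> m0; have key x : Om x -> ~ Bd m x -> ~~ (b m%:E <= (sigma x)%:E) ->
    m%:E < mu Om /\ a (sigma x) = m%:E.
  move=> Ox /not_andP[//|/negP]; rewrite -leNgt => ma.
  rewrite -ltNge => /ereal_sup_gt[_ [t [te tm] <-]]; rewrite lte_fin => st.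
  have am := le_trans (asigma_homo mOm msigma (ltW st)) tm.
  split; last by apply/eqP; rewrite eq_le am.
  by apply: (le_lt_trans (le_trans ma (asigma_homo mOm msigma (ltW st)))); rewrite -lt_emaxP.
have [mM|Mm] := ltP m%:E (mu Om); last first.
  apply: aeW => x Ox xB; apply: contrapT => /negP nx.
  by have [] := key x Ox xB nx; rewrite ltNge Mm.
exists [set x | Om x /\ a (sigma x) = m%:E]; split.
- apply: (measurable_weight_preimage mOm msigma (B := [set e | a e = m%:E])).
  apply: is_interval_measurable => x y /= ax ay z /andP[xz zy].
  by apply/eqP; rewrite eq_le -{1}ay -ax !asigma_homo.
- exact: asigma_level_null.
- move=> x /= h; apply: contrapT => nx; apply: h => Ox xB.
  by apply: contrapT => /negP /(key x Ox xB)[_ ax]; apply: nx.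
Qed.

End admissible_weight.

(** * Integrals over sets of finite measure *)

Section finite_measure_sets.
Context d (T : measurableType d) (R : realType).
Variable mu : {measure set T -> \bar R}.
Implicit Types (S : set T) (f : T -> R) (c : R).

Lemma integrable_setU_disj S S' f : measurable S -> measurable S' ->
  [disjoint S & S'] -> mu.-integrable S (EFin \o f) ->
  mu.-integrable S' (EFin \o f) -> mu.-integrable (S `|` S') (EFin \o f).
Proof.
move=> mS mS' dS /integrableP[mf fi] /integrableP[mf' fi'].
have mU : measurable_fun (S `|` S') (EFin \o f) by apply/measurable_funU.
apply/integrableP; split => //; rewrite ge0_integral_setU//.
  by rewrite lte_add_pinfty.
exact: measurableT_comp.
Qed.

Lemma fine_measureU S S' : measurable S -> measurable S' -> [disjoint S & S'] ->
  mu S < +oo -> mu S' < +oo ->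
  fine (mu (S `|` S')) = (fine (mu S) + fine (mu S'))%R.
Proof.
move=> mS mS' /eqP dS Sfin S'fin.
by rewrite measureU// fineD// ge0_fin_numE.
Qed.

Lemma integrable_cst_lty S c : measurable S -> mu S < +oo ->
  mu.-integrable S (EFin \o cst c).
Proof.
move=> mS Sfin; apply/integrableP; split; first by apply/measurable_EFinP.
by rewrite (integral_cst mu mS `|c|%:E) lte_mul_pinfty// ?lee_fin.
Qed.

Lemma Rintegral_ae_ge0 S f : measurable S -> measurable_fun S f ->
  {ae mu, forall x, S x -> (0 <= f x)%R} -> (0 <= \int[mu]_(x in S) f x)%R.
Proof.
move=> mS mf f0; rewrite /Rintegral.
rewrite (ae_eq_integral (fun x => (Num.max (f x) 0)%:E))//.
- by apply: fine_ge0; apply: integral_ge0 => x _; rewrite lee_fin le_max lexx orbT.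
- exact/measurable_EFinP.
- by apply/measurable_EFinP; apply: measurable_maxr.
- by apply: filterS f0 => x f0 Sx /=; congr EFin; apply/esym/max_idPl/f0.
Qed.

Lemma Rintegral_ae_le S f c : measurable S -> mu S < +oo ->
  mu.-integrable S (EFin \o f) ->
  {ae mu, forall x, S x -> (f x <= c)%R} ->
  (\int[mu]_(x in S) f x <= c * fine (mu S))%R.
Proof.
move=> mS Sfin fi fc; have mf := measurable_int _ fi.
rewrite -Rintegral_cst// -subr_ge0 -RintegralB//; last exact: integrable_cst_lty.
apply: Rintegral_ae_ge0 => //.
  by apply: measurable_funB => //; exact/measurable_EFinP.
by apply: filterS fc => x fc Sx; rewrite subr_ge0 fc.
Qed.

Lemma Rintegral_ae_ge S f c : measurable S -> mu S < +oo ->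
  mu.-integrable S (EFin \o f) ->
  {ae mu, forall x, S x -> (c <= f x)%R} ->
  (c * fine (mu S) <= \int[mu]_(x in S) f x)%R.
Proof.
move=> mS Sfin fi fc; have mf := measurable_int _ fi.
rewrite -Rintegral_cst// -subr_ge0 -RintegralB//; last exact: integrable_cst_lty.
apply: Rintegral_ae_ge0 => //.
  by apply: measurable_funB => //; exact/measurable_EFinP.
by apply: filterS fc => x fc Sx; rewrite subr_ge0 fc.
Qed.

Lemma ae_bounded_integrable S f c c' : measurable S -> mu S < +oo ->
  measurable_fun S f ->
  {ae mu, forall x, S x -> (c <= f x)%R} ->
  {ae mu, forall x, S x -> (f x <= c')%R} -> mu.-integrable S (EFin \o f).
Proof.
move=> mS Sfin mf fc fc'; apply/integrableP; split; first exact/measurable_EFinP.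
apply: (@le_lt_trans _ _ (\int[mu]_(x in S) (`|c| + `|c'|)%:E)); last first.
  by rewrite integral_cst// lte_mul_pinfty// lee_fin addr_ge0.
apply: ae_ge0_le_integral => //.
- by apply: measurableT_comp => //; exact/measurable_EFinP.
- apply: filterS2 fc fc' => x cf fc' Sx /=; rewrite lee_fin.
  have := cf Sx; have := fc' Sx; rewrite ler_norml.
  have := ler_norm c'; have := ler_norm (- c)%R; rewrite normrN.
  have := normr_ge0 c; have := normr_ge0 c'.
  by move=> *; apply/andP; split; lra.
Qed.

End finite_measure_sets.

(** * Sign analysis for an exchange of unequal masses *)

Section ereal_balance.
Context (R : realType).
Implicit Types (h k X Y : \bar R) (p s : R).

Local Notation defect h k p s :=
  ((Num.max 0 (s - p))%:E * k - (Num.max 0 (p - s))%:E * h).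

Let pos_case h k p s X : 0 <= h -> h <= k -> (0 <= p)%R -> (p <= s)%R ->
  h * p%:E <= X -> h * s%:E <= X + (s - p)%:E * k.
Proof.
move=> h0 hk p0 ps hX; have sp : (0 <= s - p)%R by rewrite subr_ge0.
rewrite -[in leLHS](subrKC p s) EFinD ge0_muleDr ?lee_fin//.
by apply: leeD => //; rewrite muleC lee_wpmul2l// lee_fin.
Qed.

Let defect_ge h k p s : (p <= s)%R -> defect h k p s = (s - p)%:E * k.
Proof.
move=> ps; rewrite (max_idPr _) ?subr_ge0// (max_idPl _) ?subr_le0//.
by rewrite mul0e sube0.
Qed.

Let defect_le h k p s : (s <= p)%R -> defect h k p s = - ((p - s)%:E * h).
Proof.
move=> ps; rewrite (max_idPl _) ?subr_le0// (max_idPr _) ?subr_ge0//.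
by rewrite mul0e sub0e.
Qed.

Lemma defect_pos h k p s X Y : 0 <= h -> h <= k -> (0 <= p)%R -> (0 <= s)%R ->
  h * p%:E <= X -> Y <= h * s%:E ->
  Y <= X + maxe (defect h k p s) 0 /\ maxe (- defect h k p s) 0 <= X.
Proof.
move=> h0 hk p0 s0 hX Yh; have X0 : 0 <= X by apply: le_trans hX; rewrite mule_ge0.
have [ps|sp] := leP p s.
  rewrite defect_ge//; split.
    apply: (le_trans Yh); apply: le_trans (pos_case h0 hk p0 ps hX) _.
    by rewrite leeD2l// le_max lexx.
  rewrite ge_max X0 andbT; apply: le_trans X0.
  by rewrite oppe_le0 mule_ge0 ?lee_fin ?subr_ge0// (le_trans h0).
rewrite defect_le ?(ltW sp)//; split.
  apply: (@le_trans _ _ X); last by rewrite leeDl// le_max lexx orbT.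
  apply: (le_trans Yh); apply: le_trans hX.
  by rewrite lee_wpmul2l// lee_fin ltW.
rewrite oppeK ge_max X0 andbT; apply: le_trans hX.
by rewrite muleC lee_wpmul2l// lee_fin gerBl.
Qed.

(** The mirror case with negative parts: now [X] belongs to the set lost and [Y] to the set
    gained. *)
Lemma defect_neg h k p s X Y : h <= 0 -> h <= k -> (0 <= p)%R -> (0 <= s)%R ->
  - h * s%:E <= X -> Y <= - h * p%:E ->
  Y <= X + maxe (defect h k p s) 0 /\ maxe (- defect h k p s) 0 <= X.
Proof.
move=> h0 hk p0 s0 hX Yh; have nh0 : 0 <= - h by rewrite oppe_ge0.
have X0 : 0 <= X by apply: le_trans hX; rewrite mule_ge0.
have [ps|sp] := leP p s.
  rewrite defect_ge//; split.
    apply: (@le_trans _ _ X); last by rewrite leeDl// le_max lexx orbT.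
    apply: (le_trans Yh); apply: le_trans hX.
    by rewrite lee_wpmul2l// lee_fin.
  rewrite ge_max X0 andbT; apply: le_trans hX.
  rewrite -muleN muleC; apply: (@le_trans _ _ (- h * (s - p)%:E)).
    by rewrite lee_wpmul2r ?lee_fin ?subr_ge0// leeN2.
  by rewrite lee_wpmul2l// lee_fin gerBl.
rewrite defect_le ?(ltW sp)// oppeK -muleN; split.
  apply: (le_trans Yh); apply: le_trans (pos_case nh0 (lexx _) s0 (ltW sp) hX) _.
  by rewrite leeD2l// le_max lexx.
rewrite ge_max X0 andbT; apply: le_trans X0.
by rewrite mule_ge0_le0 ?lee_fin ?subr_ge0// ltW.
Qed.

End ereal_balance.

(** * The bathtub principle and the exchange on one level *)

Section bathtub.
Context d (T : measurableType d) (R : realType).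
Variables (mu : {measure set T -> \bar R}) (Om : set T) (sigma : T -> R).
Hypotheses (mOm : measurable Om) (msigma : measurable_fun Om sigma).
Variables (B : R -> set T) (b : R -> \bar R) (em : \bar R).

(** An interface that separates the exchange argument from Lebesgue measure and from the formulas
    for [Bdom] and [bsigma]. The threshold [b] is extended-valued because [b 0] may be [-oo] and
    [b m] may be [+oo] once [m >= mu Om]. *)
Record sublevel_family : Prop := SublevelFamily {
  slf_measurable : forall m, measurable (B m) ;
  slf_sub : forall m, B m `<=` Om ;
  slf_homo : forall m m', (m <= m')%R -> B m `<=` B m' ;
  slf_set0 : forall m, (m <= 0)%R -> B m = set0 ;
  slf_measure : forall m, (0 <= m)%R -> mu (B m) = mine m%:E (mu Om) ;
  slf_le : forall m, (0 <= m)%R ->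
    {ae mu, forall x, B m x -> (sigma x)%:E <= b m} ;
  slf_ge : forall m, (0 <= m)%R ->
    {ae mu, forall x, Om x -> ~ B m x -> b m <= (sigma x)%:E} ;
  slf_b_homo : forall m m', (m <= m')%R -> b m <= b m' ;
  slf_b_gtNy : forall m, (0 < m)%R -> -oo < b m ;
  slf_b_lty : forall m, m%:E < mu Om -> b m < +oo ;
  slf_b_top : forall m, mu Om <= m%:E -> b m = em ;
  slf_Om : 0 < mu Om ;
  slf_integrable : forall m, (0 <= m)%R -> m%:E < mu Om ->
    mu.-integrable (B m) (EFin \o sigma) }.

Hypothesis slf : sublevel_family.

Local Notation ms S := (fine (mu S)).
Local Notation I S := (\int[mu]_(x in S) sigma x)%R.
Local Notation Bx m :=
  (\int[mu]_(x in B m) (sigma x)%:E + maxe 0 (m%:E - mu Om) * em).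

Let mB m : measurable (B m). Proof. exact: slf_measurable. Qed.

Lemma slf_lty m : (0 <= m)%R -> mu (B m) < +oo.
Proof. by move=> m0; rewrite slf_measure// gt_min ltry. Qed.

Lemma slf_fin m : (0 <= m)%R -> (ms (B m))%:E = mu (B m).
Proof. by move=> m0; rewrite fineK// ge0_fin_numE// slf_lty. Qed.

Lemma slf_ms_eq m : (0 <= m)%R -> m%:E <= mu Om -> ms (B m) = m.
Proof. by move=> m0 mM; rewrite slf_measure//; move/min_idPl : mM => ->. Qed.

Lemma slf_ms_top m : (0 <= m)%R -> mu Om <= m%:E -> (ms (B m))%:E = mu Om.
Proof. by move=> m0 mM; rewrite slf_fin// slf_measure//; apply/min_idPr. Qed.

Lemma slf_ms_le m : (0 <= m)%R -> (ms (B m) <= m)%R.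
Proof. by move=> m0; rewrite -lee_fin slf_fin// slf_measure// ge_min lexx. Qed.

Let msig_sub S : measurable S -> S `<=` Om -> measurable_fun S sigma.
Proof. by move=> mS SOm; exact: measurable_funS msigma. Qed.

(** If [k >= mu Om], then [B k] is [B (M / 2)] together with a set of finite measure on which
    [sigma] lies between the reals [b (M / 2)] and [c]. The choice [M / 2] is just a point strictly
    between 0 and [M]. *)
Lemma slf_integrable_real k c : (0 <= k)%R -> b k = c%:E ->
  mu.-integrable (B k) (EFin \o sigma).
Proof.
move=> k0 bk; have [kM|Mk] := ltP k%:E (mu Om); first exact: slf_integrable.
have Mf : mu Om \is a fin_num.
  by rewrite ge0_fin_numE ?measure_ge0//; exact: le_lt_trans Mk (ltry _).
pose M := ms Om; have ME : mu Om = M%:E by rewrite fineK.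
have M0 : (0 < M)%R by rewrite -lte_fin -ME; exact: slf_Om.
have m0 : (0 < M / 2)%R by rewrite divr_gt0.
have m0M : (M / 2)%:E < mu Om by rewrite ME lte_fin gtr_pMr// invf_lt1// ltr1n.
have m0k : (M / 2 <= k)%R by rewrite -lee_fin; exact: le_trans (ltW m0M) Mk.
have bf : b (M / 2)%R \is a fin_num.
  by rewrite fin_numElt slf_b_gtNy//= slf_b_lty.
rewrite -(setDUK (slf_homo slf m0k)); apply: integrable_setU_disj => //.
- exact: measurableD.
- by apply/disj_setPS => x [? []].
- by apply: slf_integrable => //; exact: ltW.
- apply: (@ae_bounded_integrable _ _ _ _ _ _ (fine (b (M / 2)%R)) c).
  + exact: measurableD.
  + by apply: le_lt_trans (slf_lty k0); apply: le_measure; rewrite ?inE//; exact: measurableD.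
  + apply: msig_sub; first exact: measurableD.
    by move=> x [/(slf_sub slf)].
  + apply: filterS (slf_ge slf (ltW m0)) => x h [Bk Bm].
    by rewrite -lee_fin fineK//; apply: h => //; exact: slf_sub Bk.
  + apply: filterS (slf_le slf k0) => x h [Bk Bm].
    by rewrite -lee_fin -bk; exact: h.
Qed.

(** The continuation has slope [em = b k] beyond [mu Om], and [k - ms (B k)] is the excess of [k]
    over [mu Om], or 0: one formula for both regimes. *)
Lemma Bx_real k c : (0 <= k)%R -> b k = c%:E ->
  Bx k = (I (B k) + (k - ms (B k)) * c)%:E.
Proof.
move=> k0 bk; have fi := slf_integrable_real k0 bk.
rewrite EFinD; congr (_ + _).
  by rewrite /Rintegral fineK//; exact: integrable_fin_num.
have [kM|Mk] := leP k%:E (mu Om).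
  rewrite slf_ms_eq// subrr mul0r.
  rewrite (_ : maxe _ _ = 0) ?mul0e//; apply/max_idPl.
  by rewrite sube_le0.
rewrite -(slf_ms_top k0 (ltW Mk)).
rewrite -(slf_b_top slf (ltW Mk)) bk -EFinB EFinM; congr (_ * _).
by apply/max_idPr; rewrite lee_fin subr_ge0 slf_ms_le.
Qed.

(** The common part of [B k] and [S] cancels, and almost everywhere [sigma - c] is nonpositive on
    the rest of [B k] and nonnegative on the rest of [S]. Subtracting [c] allows sets of different
    measures. *)
Lemma bathtub k c S : (0 <= k)%R -> b k = c%:E ->
  measurable S -> S `<=` Om -> mu S < +oo -> mu.-integrable S (EFin \o sigma) ->
  (I (B k) - c * ms (B k) <= I S - c * ms S)%R.
Proof.
move=> k0 bk mS SOm Sfin iS; have iB := slf_integrable_real k0 bk.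
have mI : measurable (B k `&` S) by exact: measurableI.
have mBS : measurable (B k `\` S) by exact: measurableD.
have mSB : measurable (S `\` B k) by exact: measurableD.
have fBS : mu (B k `\` S) < +oo.
  by apply: le_lt_trans (slf_lty k0); apply: le_measure; rewrite ?inE.
have fSB : mu (S `\` B k) < +oo.
  by apply: le_lt_trans Sfin; apply: le_measure; rewrite ?inE.
have fI : mu (B k `&` S) < +oo.
  by apply: le_lt_trans Sfin; apply: le_measure; rewrite ?inE//; exact: subIsetr.
have BE : B k = (B k `&` S) `|` (B k `\` S) by rewrite setUIDK.
have SE : S = (B k `&` S) `|` (S `\` B k) by rewrite setIC setUIDK.
have d1 : [disjoint (B k `&` S) & (B k `\` S)] by apply/disj_setPS => x [[? ?] []].
have d2 : [disjoint (B k `&` S) & (S `\` B k)] by apply/disj_setPS => x [[? ?] []].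
have IB : I (B k) = (I (B k `&` S) + I (B k `\` S))%R.
  by rewrite {1}BE Rintegral_setU// -BE.
have IS : I S = (I (B k `&` S) + I (S `\` B k))%R.
  by rewrite {1}SE Rintegral_setU// -SE.
have msB : ms (B k) = (ms (B k `&` S) + ms (B k `\` S))%R.
  by rewrite {1}BE fine_measureU.
have msS : ms S = (ms (B k `&` S) + ms (S `\` B k))%R.
  by rewrite {1}SE fine_measureU.
have h1 : (I (B k `\` S) <= c * ms (B k `\` S))%R.
  apply: Rintegral_ae_le => //; first exact: (integrableS (mB k)).
  by apply: filterS (slf_le slf k0) => x h [Bk _]; rewrite -lee_fin -bk; exact: h.
have h2 : (c * ms (S `\` B k) <= I (S `\` B k))%R.
  apply: Rintegral_ae_ge => //; first exact: (integrableS mS).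
  apply: filterS (slf_ge slf k0) => x h [Sx nB]; rewrite -lee_fin -bk.
  by apply: h => //; exact: SOm.
by rewrite IB IS msB msS; nra.
Qed.

(** The value [-oo] is excluded. The equation for [e] is conditional because at [ms (B k) = k] its
    coefficient vanishes while [b k] may be infinite. *)
Lemma Bx_cases k : (0 <= k)%R -> Bx k = +oo \/
  (mu.-integrable (B k) (EFin \o sigma) /\
   exists2 e : R, (ms (B k) < k)%R -> b k = e%:E &
     Bx k = (I (B k) + (k - ms (B k)) * e)%:E).
Proof.
move=> k0; case bk : (b k) => [c||].
- by right; split; [exact: slf_integrable_real bk|exists c => //; exact: Bx_real].
- have Mk : mu Om <= k%:E.
    by rewrite leNgt; apply/negP => /(slf_b_lty slf); rewrite bk.
  have emy : em = +oo by rewrite -bk (slf_b_top slf Mk).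
  have Mf : mu Om \is a fin_num.
    by rewrite ge0_fin_numE ?measure_ge0//; exact: le_lt_trans Mk (ltry _).
  have msk := slf_ms_top k0 Mk.
  have [iB|niB] := pselect (mu.-integrable (B k) (EFin \o sigma)).
    have Ifin := integrable_fin_num (mB k) iB.
    have [kM|nkM] := eqVneq (ms (B k)) k.
      right; split => //; exists 0%R; first by rewrite kM ltxx.
      rewrite -msk kM -EFinB subrr mul0r addr0 maxxx mul0e adde0.
      by rewrite /Rintegral fineK.
    left; rewrite emy -msk gt0_muley; last first.
      by rewrite lt_max -EFinB !lte_fin ltxx subr_gt0 lt_neqAle nkM slf_ms_le.
    by rewrite addey// -ltNye; move: Ifin; rewrite fin_numElt => /andP[].
  left; rewrite addeC emy.
  have -> : \int[mu]_(x in B k) (sigma x)%:E = +oo.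
    pose M := ms Om; have ME : mu Om = M%:E by rewrite fineK.
    have M0 : (0 < M)%R by rewrite -lte_fin -ME; exact: slf_Om.
    have m0 : (0 < M / 2)%R by rewrite divr_gt0.
    have m0M : (M / 2)%:E < mu Om by rewrite ME lte_fin gtr_pMr// invf_lt1// ltr1n.
    have m0k : (M / 2 <= k)%R by rewrite -lee_fin; exact: le_trans (ltW m0M) Mk.
    have bf : b (M / 2)%R \is a fin_num.
      by rewrite fin_numElt slf_b_gtNy//= slf_b_lty.
    have ms' : measurable_fun (B k) (EFin \o sigma).
      by apply/measurable_EFinP; apply: msig_sub => //; exact: slf_sub.
    pose c := fine (b (M / 2)%R).
    have Bfin := slf_lty k0.
    (* The negative part has finite integral: on [B (M / 2)] by integrability, elsewhere because
       [sigma >= c] on a set of finite measure. So only the positive part can spoil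
       integrability. *)
    have neg : \int[mu]_(x in B k) ((EFin \o sigma)^\- x) < +oo.
      have im := slf_integrable slf (ltW m0) m0M.
      pose Dk := B k `\` B (M / 2)%R.
      have mD : measurable Dk by exact: measurableD.
      have DB : Dk `<=` B k by move=> x [].
      rewrite -(setDUK (slf_homo slf m0k)) ge0_integral_setU//.
      - apply: lte_add_pinfty; first exact: (integral_funeneg_lt_pinfty _ im).
        apply: (@le_lt_trans _ _ (\int[mu]_(x in Dk) `|c|%:E)); last first.
          rewrite integral_cst// lte_mul_pinfty ?lee_fin//.
          by apply: le_lt_trans Bfin; apply: le_measure; rewrite ?inE.
        apply: ae_ge0_le_integral => //.
        + by apply: measurable_funeneg; exact: measurable_funS ms'.
        + apply: filterS (slf_ge slf (ltW m0)) => x h [Bk Bm].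
          have := h (slf_sub slf Bk) Bm; rewrite -(fineK bf) lee_fin -/c => cx.
          rewrite funenegE /= ge_max !lee_fin normr_ge0 andbT.
          by rewrite -normrN (le_trans _ (ler_norm _))// lerN2.
      - apply: measurable_funeneg; rewrite setDUK//; exact: slf_homo.
      - by apply/disj_setPS => x [? []].
    rewrite integralE.
    have -> : \int[mu]_(x in B k) ((EFin \o sigma)^\+ x) = +oo.
      apply/eqP; rewrite -leye_eq leNgt; apply/negP => pos; apply: niB.
      apply/integrableP; split => //.
      rewrite (_ : (fun x => _) = (EFin \o sigma)^\+ \+ (EFin \o sigma)^\-).
        rewrite ge0_integralD//; first exact: lte_add_pinfty.
          exact: measurable_funepos.
        exact: measurable_funeneg.
      by rewrite -fune_abse.
    by rewrite addye// -ltNye lteNr.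
  rewrite addey// -ltNye; apply: (@lt_le_trans _ _ 0); first exact: ltNyr.
  by rewrite mule_ge0// le_max lexx.
- right; have k00 : k = 0%R.
    apply/eqP; rewrite eq_le k0 andbT leNgt; apply/negP => /(slf_b_gtNy slf).
    by rewrite bk.
  rewrite k00 (slf_set0 slf (lexx _)); split; first exact: integrable_set0.
  exists 0%R; first by rewrite measure0 ltxx.
  rewrite Rintegral_set0 integral_set0 measure0 subrr mul0r addr0 add0e.
  rewrite (_ : maxe _ _ = 0) ?mul0e//; apply/max_idPl.
  by rewrite sub0e oppe_le0 measure_ge0.
Qed.

(** The bathtub inequality at level [m], tested on [B k]. If [k] exceeds [mu Om], the missing mass
    [k - ms (B k)] is continued with slope [b k >= c]. *)
Lemma Bx_subgradient m c k : (0 <= m)%R -> b m = c%:E -> (0 <= k)%R ->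
  Bx m + (c * (k - m))%:E <= Bx k.
Proof.
move=> m0 bm k0; have [->|[iB [e be ->]]] := Bx_cases k0; first exact: leey.
rewrite (Bx_real m0 bm) -EFinD lee_fin.
have := bathtub m0 bm (mB k) (slf_sub slf (m := k)) (slf_lty k0) iB.
have : (0 <= (k - ms (B k)) * (e - c))%R.
  have := slf_ms_le k0; rewrite le_eqVlt => /predU1P[->|kM].
    by rewrite subrr mul0r.
  apply: mulr_ge0; first by rewrite subr_ge0 ltW.
  rewrite subr_ge0 -lee_fin -bm -(be kM).
  have Mk : mu Om <= k%:E.
    rewrite leNgt; apply/negP => /ltW kM'; move: kM; rewrite slf_ms_eq//.
    by rewrite ltxx.
  have [mM|Mm] := ltP m%:E (mu Om); last by rewrite !(slf_b_top slf).
  by apply: (slf_b_homo slf); rewrite -lee_fin (le_trans (ltW mM)).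
nra.
Qed.

Let dsumE (x y z : R) :
  ((x%:E + y%:E - 2%:E * z%:E)%dE : \bar R) = (x + y - 2 * z)%:E.
Proof. by []. Qed.

Definition second_difference m s : \bar R :=
  (Bx (m + s)%R + Bx (m - s)%R - 2%:E * Bx m)%dE.

(** The subgradient inequalities for [m + s] and [m - s] add up with cancelling linear terms. If
    [b m = +oo], then [m = mu Om] and [Bx (m + s) = +oo], which the dual addition lets prevail. *)
Lemma second_difference_ge0 m s : (0 < m)%R -> m%:E <= mu Om ->
  (0 < s <= m)%R -> 0 <= second_difference m s.
Proof.
move=> m0 mM /andP[s0 sm]; have ms0 : (0 <= m - s)%R by rewrite subr_ge0.
have mps0 : (0 <= m + s)%R by rewrite addr_ge0// ltW.
rewrite /second_difference.
case bm : (b m) => [c||].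
- have := Bx_subgradient (ltW m0) bm mps0; have := Bx_subgradient (ltW m0) bm ms0.
  rewrite (Bx_real (ltW m0) bm).
  have [->|[_ [e1 _ ->]]] := Bx_cases mps0; first by rewrite DualAddTheoryNumDomain.daddye DualAddTheoryNumDomain.daddye leey.
  have [->|[_ [e2 _ ->]]] := Bx_cases ms0; first by rewrite DualAddTheoryNumDomain.daddey DualAddTheoryNumDomain.daddye leey.
  by rewrite dsumE -!EFinD !lee_fin => h1 h2; lra.
- have Mm : mu Om <= m%:E by rewrite leNgt; apply/negP => /(slf_b_lty slf); rewrite bm.
  have [->|[_ [e be _]]] := Bx_cases mps0; first by rewrite DualAddTheoryNumDomain.daddye DualAddTheoryNumDomain.daddye leey.
  have Mms : mu Om <= (m + s)%:E by rewrite (le_trans Mm)// lee_fin lerDl ltW.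
  have : (ms (B (m + s)%R) < m + s)%R.
    by rewrite -lte_fin slf_ms_top//; apply: le_lt_trans Mm _; rewrite lte_fin ltrDl.
  by move=> /be; rewrite (slf_b_top slf Mms) -(slf_b_top slf Mm) bm.
- by have := slf_b_gtNy slf m0; rewrite bm.
Qed.

(** Becomes [Hsigma] for [Bdom] and [bsigma]: a lower bound for the curvature of the primitive at
    [m] over all steps up to [m]. *)
Definition stiffness m : \bar R :=
  ereal_inf [set second_difference m s * ((s ^+ 2)^-1)%:E | s in
             [set s : R | (0 < s <= m)%R]].

Lemma stiffness_ge0 m : (0 <= m)%R -> m%:E <= mu Om -> 0 <= stiffness m.
Proof.
move=> m0 mM; apply: le_ereal_inf_tmp => _ [s /= /andP[s0 sm] <-].
have m1 := lt_le_trans s0 sm.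
by rewrite mule_ge0 ?lee_fin ?invr_ge0 ?sqr_ge0// second_difference_ge0// s0.
Qed.

(** With [h] the stiffness, expand [(l h s - 1)^2 / h >= 0] and use [h s^2 <= z]. For [h = 0] the
    inverse is [+oo]; [h = +oo] is impossible since [z] is real. *)
Lemma stiffness_young m s z l : (0 <= m)%R -> m%:E <= mu Om -> (0 < s <= m)%R ->
  second_difference m s <= z%:E ->
  (l * (2 * s) - l ^+ 2 * z)%:E <= (stiffness m)^-1.
Proof.
move=> m0 mM sm sz; have /andP[s0 _] := sm.
have H0 := stiffness_ge0 m0 mM.
have s20 : (0 < s ^+ 2)%R by rewrite exprn_gt0.
have : stiffness m <= (z / s ^+ 2)%:E.
  apply: (@le_trans _ _ (second_difference m s * ((s ^+ 2)^-1)%:E)).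
    by apply: ereal_inf_lbound; exists s.
  by rewrite EFinM lee_wpmul2r// lee_fin invr_ge0 ltW.
case: (stiffness m) H0 => [h||]//; rewrite ?leye_eq// !lee_fin => h0 hz.
rewrite inver; case: eqVneq => [_|hn0]; first by rewrite leey.
rewrite lee_fin; have hp : (0 < h)%R by rewrite lt_neqAle eq_sym hn0.
have zs : (h * s ^+ 2 <= z)%R by rewrite -ler_pdivlMr.
have : (0 <= h^-1 - l * (2 * s) + l ^+ 2 * (h * s ^+ 2))%R.
  have -> : (h^-1 - l * (2 * s) + l ^+ 2 * (h * s ^+ 2) = (l * h * s - 1) ^+ 2 / h)%R.
    by field.
  by rewrite divr_ge0 ?sqr_ge0.
by have := ler_wpM2l (sqr_ge0 l) zs; lra.
Qed.

Lemma conull_integral S : measurable S -> S `<=` Om -> mu (Om `\` S) = 0 ->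
  \int[mu]_(x in S) (sigma x)%:E = \int[mu]_(x in Om) (sigma x)%:E.
Proof.
move=> mS SOm S0; have mD : measurable (Om `\` S) by exact: measurableD.
rewrite -(setDUK SOm) integral_setU//.
- rewrite [X in _ = _ + X]null_set_integral ?adde0//.
  by apply/measurable_EFinP; apply: msig_sub => // x [].
- by rewrite setDUK//; exact/measurable_EFinP.
- by apply/disj_setPS => x [? []].
Qed.

Variables (A : set T) (m : R).
Hypotheses (mA : measurable A) (AOm : A `<=` Om) (Afin : mu A < +oo).
Hypotheses (m0 : (0 <= m)%R) (mM : m%:E <= mu Om).

(** Replacing [B m] by [A] gains [U] and loses [V]; [defect] below is the charge for [p] and [s]
    being different. *)
Let U := A `\` B m.
Let V := B m `\` A.
Let p := ms U.
Let s := ms V.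
Let h := b m.
Let k := b (2 * m)%R.
Let sig := EFin \o sigma.
Let Up := \int[mu]_(x in U) sig^\+ x.
Let Un := \int[mu]_(x in U) sig^\- x.
Let Vp := \int[mu]_(x in V) sig^\+ x.
Let Vn := \int[mu]_(x in V) sig^\- x.
Let defect := (Num.max 0 (s - p))%:E * k - (Num.max 0 (p - s))%:E * h.

Let mU : measurable U. Proof. exact: measurableD. Qed.
Let mV : measurable V. Proof. exact: measurableD. Qed.
Let UOm : U `<=` Om. Proof. by move=> x [/AOm]. Qed.
Let VOm : V `<=` Om. Proof. by move=> x [/(slf_sub slf)]. Qed.
Let Ufin : mu U < +oo.
Proof. by apply: le_lt_trans Afin; apply: le_measure; rewrite ?inE//; exact: subDsetl. Qed.
Let Vfin : mu V < +oo.
Proof. by apply: le_lt_trans (slf_lty m0); apply: le_measure; rewrite ?inE//; exact: subDsetl. Qed.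
Let pE : mu U = p%:E. Proof. by rewrite fineK// ge0_fin_numE. Qed.
Let sE : mu V = s%:E. Proof. by rewrite fineK// ge0_fin_numE. Qed.
Let p0 : (0 <= p)%R. Proof. exact: fine_ge0. Qed.
Let s0 : (0 <= s)%R. Proof. exact: fine_ge0. Qed.
Let hk : h <= k. Proof. by apply: (slf_b_homo slf); rewrite mulr_natl mulr2n lerDl. Qed.
Let msigS S : measurable S -> S `<=` Om -> measurable_fun S sig.
Proof. by move=> mS SOm; apply/measurable_EFinP; exact: msig_sub. Qed.

Let ae_int_le S (g : T -> \bar R) (e : \bar R) : measurable S -> measurable_fun S g ->
  (forall x, 0 <= g x) -> 0 <= e -> {ae mu, forall x, S x -> g x <= e} ->
  \int[mu]_(x in S) g x <= e * mu S.
Proof.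
move=> mS mg g0 e0 ge; rewrite -integral_cst//.
by apply: ae_ge0_le_integral.
Qed.

Let ae_int_ge S (g : T -> \bar R) (e : \bar R) : measurable S -> measurable_fun S g ->
  (forall x, 0 <= g x) -> 0 <= e -> {ae mu, forall x, S x -> e <= g x} ->
  e * mu S <= \int[mu]_(x in S) g x.
Proof.
move=> mS mg g0 e0 ge; rewrite -integral_cst//.
by apply: ae_ge0_le_integral.
Qed.

Let sigU : {ae mu, forall x, U x -> h <= sig x}.
Proof. by apply: filterS (slf_ge slf m0) => x hx [Ax nB]; apply: hx => //; exact: AOm. Qed.
Let sigV : {ae mu, forall x, V x -> sig x <= h}.
Proof. by apply: filterS (slf_le slf m0) => x hx [Bx _]; exact: hx. Qed.

(** [h] separates [sigma] on [U] from [sigma] on [V], so its sign makes [Un] or [Vp] vanish. The two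
    inequalities let finiteness of [Up + Vn] and of the positive part of [defect] propagate to all
    other terms. *)
Lemma exchange_balance :
  Un + Vp <= Up + Vn + maxe defect 0 /\ maxe (- defect) 0 <= Up + Vn.
Proof.
have msU := msigS mU UOm; have msV := msigS mV VOm.
have Up0 : 0 <= Up by exact: integral_ge0.
have Vn0 : 0 <= Vn by exact: integral_ge0.
have d0 : 0 <= maxe defect 0 by rewrite le_max lexx orbT.
have [h0|h0] := leP 0 h.
  have Un0 : Un = 0.
    apply/eqP; rewrite eq_le integral_ge0// andbT -(mul0e (mu U)).
    apply: ae_int_le => //; first exact: measurable_funeneg.
    apply: filterS sigU => x hx /hx; rewrite funenegE => hs.
    by rewrite ge_max lexx andbT oppe_le0 (le_trans h0).
  have UpE : h * p%:E <= Up.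
    rewrite -pE; apply: ae_int_ge => //; first exact: measurable_funepos.
    by apply: filterS sigU => x hx /hx hs; rewrite funeposE le_max hs.
  have VpE : Vp <= h * s%:E.
    rewrite -sE; apply: ae_int_le => //; first exact: measurable_funepos.
    by apply: filterS sigV => x hx /hx hs; rewrite funeposE ge_max hs.
  have [h1 h2] := defect_pos h0 hk p0 s0 UpE VpE.
  rewrite Un0 add0e; split; last by rewrite (le_trans h2)// leeDl.
  by rewrite (le_trans h1)// leeD2r// leeDl.
have {}h0 := ltW h0.
have Vp0 : Vp = 0.
  apply/eqP; rewrite eq_le integral_ge0// andbT -(mul0e (mu V)).
  apply: ae_int_le => //; first exact: measurable_funepos.
  apply: filterS sigV => x hx /hx; rewrite funeposE => hs.
  by rewrite ge_max lexx andbT (le_trans hs).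
have VnE : - h * s%:E <= Vn.
  rewrite -sE; apply: ae_int_ge => //; first exact: measurable_funeneg.
    by rewrite oppe_ge0.
  by apply: filterS sigV => x hx /hx hs; rewrite funenegE le_max leeN2 hs.
have UnE : Un <= - h * p%:E.
  rewrite -pE; apply: ae_int_le => //; first exact: measurable_funeneg.
    by rewrite oppe_ge0.
  by apply: filterS sigU => x hx /hx hs; rewrite funenegE ge_max leeN2 hs oppe_ge0.
have [h1 h2] := defect_neg h0 hk p0 s0 VnE UnE.
rewrite Vp0 adde0; split; last by rewrite (le_trans h2)// leeDr.
by rewrite (le_trans h1)// leeD2r// leeDr.
Qed.

Let null_Rintegral S : measurable S -> S `<=` Om -> mu S = 0 -> I S = 0%R.
Proof.
move=> mS SOm S0; rewrite /Rintegral null_set_integral//; exact: msigS.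
Qed.

Let Rint_funeE S : measurable S -> S `<=` Om ->
  \int[mu]_(x in S) sig^\+ x < +oo -> \int[mu]_(x in S) sig^\- x < +oo ->
  mu.-integrable S sig /\
  I S = (fine (\int[mu]_(x in S) sig^\+ x) - fine (\int[mu]_(x in S) sig^\- x))%R.
Proof.
move=> mS SOm pfin nfin; split.
  apply/integrableP; split; first exact: msigS.
  rewrite (_ : (fun x => _) = sig^\+ \+ sig^\-); last by rewrite -fune_abse.
  rewrite ge0_integralD//; first exact: lte_add_pinfty.
    by apply: measurable_funepos; exact: msigS.
  by apply: measurable_funeneg; exact: msigS.
by rewrite /Rintegral integralE fineB// ge0_fin_numE// integral_ge0.
Qed.

(** Here [z] is [I U - I V + defect], kept as a difference of nonnegative quantities that can be
    integrated separately. The bathtub inequality is tested on the intersection of [B m] and [A] for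
    [m - s], and on their union for [m + s]. *)
Lemma exchange_second_difference : Up + Vn + maxe defect 0 < +oo ->
  let z := (fine (Up + Vn + maxe defect 0)%E - fine (Un + Vp + maxe (- defect) 0)%E)%R in
  (0 <= z)%R /\ ((0 < s)%R -> (s <= m)%R /\ second_difference m s <= z%:E).
Proof.
move=> Pfin; have [bal1 bal2] := exchange_balance.
have Up0 : 0 <= Up by exact: integral_ge0.
have Vn0 : 0 <= Vn by exact: integral_ge0.
have Un0 : 0 <= Un by exact: integral_ge0.
have Vp0 : 0 <= Vp by exact: integral_ge0.
have dp0 : 0 <= maxe defect 0 by rewrite le_max lexx orbT.
have dn0 : 0 <= maxe (- defect) 0 by rewrite le_max lexx orbT.
have UVfin : Up + Vn < +oo by apply: le_lt_trans Pfin; rewrite leeDl.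
have Upf : Up < +oo by apply: le_lt_trans UVfin; rewrite leeDl.
have Vnf : Vn < +oo by apply: le_lt_trans UVfin; rewrite leeDr.
have dpf : maxe defect 0 < +oo by apply: le_lt_trans Pfin; rewrite leeDr// adde_ge0.
have dnf : maxe (- defect) 0 < +oo by exact: le_lt_trans UVfin.
have UnVpf : Un + Vp < +oo by exact: le_lt_trans Pfin.
have Unf : Un < +oo by apply: le_lt_trans UnVpf; rewrite leeDl.
have Vpf : Vp < +oo by apply: le_lt_trans UnVpf; rewrite leeDr.
have [iU IU] := Rint_funeE mU UOm Upf Unf.
have [iV IV] := Rint_funeE mV VOm Vpf Vnf.
have dfin : defect \is a fin_num.
  rewrite fin_numElt; apply/andP; split; last first.
    by apply: le_lt_trans dpf; rewrite le_max lexx.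
  by rewrite -(oppeK defect) lteNr /=; apply: le_lt_trans dnf; rewrite le_max lexx.
have dE : fine defect = (fine (maxe defect 0%E) - fine (maxe (- defect)%E 0%E))%R.
  rewrite -(fineK dfin); set D := fine defect; rewrite /=.
  rewrite -!EFin_max /=; case: (leP D 0%R) => D0.
    by rewrite (max_idPl _) ?oppr_ge0// sub0r opprK.
  by rewrite (max_idPr _) ?subr0// oppr_le0 ltW.
move=> z; have zE : z = (I U - I V + fine defect)%R.
  have fD (x y : \bar R) : 0 <= x -> 0 <= y -> x < +oo -> y < +oo ->
      fine (x + y) = (fine x + fine y)%R.
    by move=> *; rewrite fineD// ge0_fin_numE.
  have e1 := fD _ _ (adde_ge0 Up0 Vn0) dp0 UVfin dpf.
  have e2 := fD _ _ (adde_ge0 Un0 Vp0) dn0 UnVpf dnf.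
  rewrite /z e1 e2 (fD _ _ Up0 Vn0 Upf Vnf) (fD _ _ Un0 Vp0 Unf Vpf).
  by rewrite dE IU IV -/Up -/Un -/Vp -/Vn; ring.
have ipI : (mu Om <= m%:E) -> p = 0%R.
  move=> Mm; have : (ms (B m) + p <= ms (B m))%R.
    rewrite -lee_fin (slf_ms_top m0 Mm) EFinD slf_fin// -pE -measureU//.
      apply: le_measure; rewrite ?inE//; first exact: measurableU.
      by move=> x [/(slf_sub slf)//|/UOm].
    by apply/eqP/disj_setPS => x [? []].
  by rewrite gerDl => p00; apply/eqP; rewrite eq_le p00 p0.
have iVs : (m <= 0)%R -> s = 0%R.
  by move=> /(slf_set0 slf) Bm0; rewrite /s /V Bm0 set0D measure0.
(* If [U] and [V] are both null, then [z = 0] whatever [h] and [k] are. *)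
have [ps0|psn0] := pselect (p = 0%R /\ s = 0%R).
  have [pz sz] := ps0.
  rewrite zE !null_Rintegral ?pE ?sE ?pz ?sz//.
  rewrite /defect pz sz subrr maxxx !mul0e sube0 /= addr0.
  by split => //; rewrite ltxx.
(* An infinite [h] would make [defect] infinite: [h = +oo] needs [m >= mu Om], so [p = 0 < s] and
   [k = +oo]; [h = -oo] needs [m = 0], so [s = 0 < p]. *)
have [c hc] : exists c, h = c%:E.
  rewrite /h; case hE : (b m) => [c||]; first by exists c.
  - have Mm : mu Om <= m%:E by rewrite leNgt; apply/negP => /(slf_b_lty slf); rewrite hE.
    have pz := ipI Mm.
    have sp : (0 < s)%R.
      by rewrite lt_neqAle s0 andbT eq_sym; apply/negP => /eqP sz; apply: psn0.
    have ky : k = +oo by apply/eqP; rewrite -leye_eq -hE; exact: hk.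
    move: dfin; rewrite /defect pz subr0 sub0r ky (max_idPr _) ?(ltW sp)//.
    rewrite (max_idPl _) ?oppr_le0// mul0e sube0 gt0_muley ?lte_fin//.
  - have m00 : (m <= 0)%R by rewrite leNgt; apply/negP => /(slf_b_gtNy slf); rewrite hE.
    have sz := iVs m00.
    have pp : (0 < p)%R.
      by rewrite lt_neqAle p0 andbT eq_sym; apply/negP => /eqP pz; apply: psn0.
    move: dfin; rewrite /defect sz subr0 sub0r /h hE (max_idPl _) ?oppr_le0//.
    by rewrite (max_idPr _) ?(ltW pp)// mul0e gt0_muleNy ?lte_fin.
have hU : (c * p <= I U)%R.
  apply: Rintegral_ae_ge => //; apply: filterS sigU => x hx /hx.
  by rewrite hc lee_fin.
have hV : (I V <= c * s)%R.
  apply: Rintegral_ae_le => //; apply: filterS sigV => x hx /hx.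
  by rewrite hc lee_fin.
have dle : (s <= p)%R -> fine defect = (- ((p - s) * c))%R.
  move=> sp; rewrite /defect (max_idPl _) ?subr_le0// (max_idPr _) ?subr_ge0//.
  by rewrite mul0e sub0e hc.
have dgt : (p < s)%R -> exists2 e, k = e%:E & fine defect = ((s - p) * e)%R.
  move=> ps; have sp0 : (0 < s - p)%R by rewrite subr_gt0.
  move: dfin; rewrite /defect (max_idPr _) ?(ltW sp0)// (max_idPl _) ?subr_le0 ?(ltW ps)//.
  rewrite mul0e sube0; have := hk; rewrite hc; case: k => [e||]//.
  - by move=> _ _; exists e.
  - by rewrite gt0_muley.
split.
  rewrite zE; have [sp|ps] := leP s p; first by rewrite dle//; lra.
  have [e ke ->] := dgt ps; have := hk; rewrite hc ke lee_fin => ce.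
  have : (0 <= (s - p) * (e - c))%R by rewrite mulr_ge0 ?subr_ge0// ltW.
  lra.
move=> sp; have msm : ms (B m) = m by exact: slf_ms_eq.
have sm : (s <= m)%R.
  rewrite -lee_fin -sE -msm slf_fin//; apply: le_measure; rewrite ?inE//.
  exact: subDsetl.
split => //.
have mp : (0 < m)%R by exact: lt_le_trans sp sm.
have iB := slf_integrable_real m0 hc.
have Bm : Bx m = (I (B m))%:E by rewrite (Bx_real m0 hc) msm subrr mul0r addr0.
pose S1 := B m `&` A.
have mS1 : measurable S1 by exact: measurableI.
have S1Om : S1 `<=` Om by move=> x [_ /AOm].
have S1fin : mu S1 < +oo.
  by apply: le_lt_trans (slf_lty m0); apply: le_measure; rewrite ?inE//; exact: subIsetl.
have BmE : B m = S1 `|` V by rewrite setUIDK.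
have dS1 : [disjoint S1 & V] by apply/disj_setPS => x [[? ?] []].
have IS1 : (I S1 = I (B m) - I V)%R.
  by rewrite [in RHS]BmE Rintegral_setU// -?BmE// addrK.
have msS1 : ms S1 = (m - s)%R.
  by apply/eqP; rewrite eq_sym subr_eq -msm [in eqbLHS]BmE fine_measureU.
(* [S1] has measure exactly [m - s], so it competes with [B (m - s)]. The case [m = s] is separate
   because [b 0] may be [-oo]. *)
have [rl Bl rl_le] : exists2 r, Bx (m - s)%R = r%:E & (r <= I (B m) - I V)%R.
  have ms0 : (0 <= m - s)%R by rewrite subr_ge0.
  have msM : (m - s)%:E <= mu Om by rewrite (le_trans _ mM)// lee_fin gerBl.
  move: ms0; rewrite le_eqVlt => /predU1P[ms0|ms0].
    exists 0%R.
      rewrite -ms0 (slf_set0 slf (lexx _)) integral_set0 add0e.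
      rewrite (_ : maxe _ _ = 0) ?mul0e//; apply/max_idPl.
      by rewrite sub0e oppe_le0 measure_ge0.
    rewrite -IS1 null_Rintegral//; apply/eqP.
    by rewrite -[mu S1]fineK ?ge0_fin_numE// msS1 -ms0.
  have [c' bc'] : exists c', b (m - s)%R = c'%:E.
    have := slf_b_gtNy slf ms0.
    have : b (m - s)%R <= h by apply: (slf_b_homo slf); rewrite gerBl.
    by rewrite hc; case: (b _) => [c'||]// _ _; exists c'.
  exists (I (B (m - s)%R)).
    by rewrite (Bx_real (ltW ms0) bc') (slf_ms_eq (ltW ms0) msM) subrr mul0r addr0.
  have iS1 : mu.-integrable S1 sig.
    by apply: (integrableS (mB m)) => //; exact: subIsetl.
  have := bathtub (ltW ms0) bc' mS1 S1Om S1fin iS1.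
  by rewrite (slf_ms_eq (ltW ms0) msM) msS1 -IS1; lra.
pose S2 := B m `|` U.
have mS2 : measurable S2 by exact: measurableU.
have S2Om : S2 `<=` Om by move=> x [/(slf_sub slf)|/UOm].
have dS2 : [disjoint B m & U] by apply/disj_setPS => x [? []].
have iS2 : mu.-integrable S2 sig by exact: integrable_setU_disj.
have IS2 : (I S2 = I (B m) + I U)%R by rewrite Rintegral_setU.
have msS2 : (ms S2 = m + p)%R by rewrite fine_measureU// ?msm// slf_lty.
have S2fin : mu S2 < +oo.
  by rewrite measureU ?lte_add_pinfty ?slf_lty//; apply/eqP.
have mps : (0 < m + s)%R by rewrite addr_gt0.
have m2s : b (m + s)%R <= k.
  by apply: (slf_b_homo slf); rewrite mulr_natl mulr2n lerD2l.
have hms : h <= b (m + s)%R by apply: (slf_b_homo slf); rewrite lerDl.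
(* [S2] has measure [m + p] instead of [m + s]; the mismatch is absorbed by [defect], since
   [b (m + s)] lies between [h] and [k]. *)
have [ru Bu ru_le] : exists2 r, Bx (m + s)%R = r%:E &
    (r <= I (B m) + I U + fine defect)%R.
  case bms : (b (m + s)%R) => [c'||].
  - exists (I (B (m + s)%R) + (m + s - ms (B (m + s)%R)) * c')%R.
      exact: Bx_real (ltW mps) bms.
    have := bathtub (ltW mps) bms mS2 S2Om S2fin iS2; rewrite IS2 msS2.
    have [sp'|ps] := leP s p.
      rewrite dle//; move: hms; rewrite hc bms lee_fin => cc'.
      have : (0 <= (p - s) * (c' - c))%R by rewrite mulr_ge0 ?subr_ge0.
      lra.
    have [e ke ->] := dgt ps; move: m2s; rewrite bms ke lee_fin => ce.
    have : (0 <= (s - p) * (e - c'))%R by rewrite mulr_ge0 ?subr_ge0// ltW.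
    lra.
  (* Now [S2] must fill [Om]: finiteness of [defect] gives [s <= p], and [m + p <= mu Om <= m + s]
     gives [p = s]. Both [S2] and [B (m + s)] are conull, so their integrals agree. *)
  - have Mm : mu Om <= (m + s)%:E.
      by rewrite leNgt; apply/negP => /(slf_b_lty slf); rewrite bms.
    have Mf : mu Om < +oo by exact: le_lt_trans Mm (ltry _).
    have sp' : (s <= p)%R.
      rewrite leNgt; apply/negP => /dgt[e ke _].
      by move: m2s; rewrite bms ke leye_eq.
    have S2M : (m + p)%:E <= mu Om.
      rewrite -msS2 fineK ?ge0_fin_numE//; apply: le_measure; rewrite ?inE//.
    have ps : p = s.
      apply/eqP; rewrite eq_le sp' andbT -(lerD2l m) -lee_fin.
      exact: le_trans S2M Mm.
    have ME : mu Om = (m + s)%:E by apply/eqP; rewrite eq_le Mm -ps S2M.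
    have conull S : measurable S -> S `<=` Om -> mu S = mu Om -> mu (Om `\` S) = 0.
      move=> mS SOm SE; rewrite measureD// setIidr//.
      transitivity (mu Om - mu Om); first by congr (_ - _).
      rewrite subee//.
      by rewrite ge0_fin_numE.
    exists (I S2); last by rewrite IS2 dle// ps subrr mul0r oppr0 addr0.
    rewrite ME -EFinB subrr maxxx mul0e adde0.
    rewrite conull_integral//; last 2 first.
    + exact: slf_sub.
    + by apply: conull => //; [exact: slf_sub|rewrite (slf_measure slf (ltW mps)) ME minxx].
    rewrite -(conull_integral mS2 S2Om).
      by rewrite /Rintegral fineK//; exact: integrable_fin_num.
    by apply: conull => //; rewrite -[LHS]fineK ?ge0_fin_numE// msS2 ps ME.
  - by have := slf_b_gtNy slf mps; rewrite bms.
rewrite /second_difference Bu Bl Bm dsumE lee_fin zE; lra.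
Qed.

End bathtub.

(** * From single levels to integrals: the optimised linear bound *)

Section energy.
Context d (T : measurableType d) (R : realType).
Variable mu : {measure set T -> \bar R}.

(** The integral of a nonnegative function is a supremum over the simple functions below it, hence
    monotone for arbitrary functions. This accommodates [1 / Hsigma], whose measurability is not
    established. *)
Lemma ge0_le_integral_lower (D : set T) (g h : T -> \bar R) :
  (forall x, D x -> 0 <= g x) -> (forall x, D x -> g x <= h x) ->
  \int[mu]_(x in D) g x <= \int[mu]_(x in D) h x.
Proof.
move=> g0 gh; have h0 x : D x -> 0 <= h x by move=> Dx; rewrite (le_trans (g0 _ Dx))// gh.
rewrite !ge0_integralE//; apply: le_ereal_sup => _ [k kg <-]; exists k => // x.
apply: (le_trans (kg x)); rewrite /patch; case: ifPn => //; rewrite inE; exact: gh.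
Qed.

(** The optimal choice is [l = S / Z]. A negative [Z] is refuted by a large [l], and [Z = 0] with
    [S > 0] by [l = (k + 1) / (2 S)]. *)
Lemma quadratic_bound (S Z k : R) : (0 <= S)%R -> (0 <= k)%R ->
  (forall l, (0 < l)%R -> (l * (2 * S) <= l ^+ 2 * Z + k)%R) ->
  ((2 * S) ^+ 2 <= 4 * k * Z)%R.
Proof.
move=> S0 k0 h; have Z0 : (0 <= Z)%R.
  rewrite leNgt; apply/negP => Z0.
  (* This [l] satisfies [l >= 1] and [l Z <= - (k + 1)], so [l^2 Z + k < 0], against
     [l (2 S) >= 0]. *)
  have := h (1 + (k + 1) / - Z)%R.
  set l := (1 + _)%R; have l1 : (1 <= l)%R.
    by rewrite lerDl divr_ge0 ?addr_ge0// oppr_ge0 ltW.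
  have lZ : (l * Z <= - (k + 1))%R.
    by rewrite /l mulrDl mul1r invrN mulrN mulNr -mulrA mulVf ?lt_eqF// mulr1 gerDr ltW.
  move=> /(_ (lt_le_trans ltr01 l1)).
  have : (0 <= l * (2 * S))%R by rewrite mulr_ge0// ?mulr_ge0// (le_trans ler01).
  nra.
have [S00|Sn0] := eqVneq S 0%R; first by rewrite S00 mulr0 expr0n/= !mulr_ge0.
have Sp : (0 < S)%R by rewrite lt_neqAle eq_sym Sn0.
have [Zz|Zn0] := eqVneq Z 0%R.
  have := h ((k + 1) / (2 * S))%R.
  rewrite Zz mulr0 add0r divr_gt0 ?mulr_gt0// ?ltr_wpDl// => /(_ isT).
  by rewrite divfK ?mulf_neq0// => ?; exfalso; lra.
have Zp : (0 < Z)%R by rewrite lt_neqAle eq_sym Zn0.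
have := h (S / Z)%R (divr_gt0 Sp Zp).
have -> : (S / Z * (2 * S) = 2 * S ^+ 2 / Z)%R by field.
have -> : ((S / Z) ^+ 2 * Z = S ^+ 2 / Z)%R by field.
rewrite -lerBlDl -mulrBl ler_pdivrMr// => h1.
by rewrite exprMn; nra.
Qed.

(** Every integrand is nonnegative, so integrals are split before finiteness is known; that of [N]
    and [F^-] then follows from the pointwise balance. *)
Lemma energy_bound (D : set T) (P N F : T -> \bar R) (s : T -> R) (G : T -> \bar R) :
  measurable D ->
  measurable_fun D P -> measurable_fun D N -> measurable_fun D F ->
  measurable_fun D s ->
  (forall t, D t -> 0 <= P t) -> (forall t, D t -> 0 <= N t) ->
  (forall t, D t -> (0 <= s t)%R) -> (forall t, D t -> 0 <= G t) ->
  (forall t, D t -> N t <= P t + F^\+ t) ->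
  (forall t, D t -> F^\- t <= P t) ->
  (forall t l, D t -> P t + F^\+ t < +oo -> (0 < l)%R ->
    (l * (2 * s t) - l ^+ 2 * (fine (P t + F^\+ t)%E - fine (N t + F^\- t)%E))%:E <= G t) ->
  \int[mu]_(t in D) (s t)%:E < +oo -> \int[mu]_(t in D) G t < +oo ->
  \int[mu]_(t in D) P t < +oo -> \int[mu]_(t in D) F^\+ t < +oo ->
  exists Z : R, (\int[mu]_(t in D) P t - \int[mu]_(t in D) N t) +
     \int[mu]_(t in D) F t = Z%:E /\
    ((2 * fine (\int[mu]_(t in D) (s t)%:E)) ^+ 2 <=
      4 * fine (\int[mu]_(t in D) G t) * Z)%R.
Proof.
move=> mD mP mN mF ms P0 N0 s0 G0 NP FP HG Sfin Gfin Pfin Fpfin.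
have mFp : measurable_fun D F^\+ by exact: measurable_funepos.
have mFn : measurable_fun D F^\- by exact: measurable_funeneg.
have PFfin : \int[mu]_(t in D) (P t + F^\+ t) < +oo.
  by rewrite ge0_integralD//; exact: lte_add_pinfty.
have mPF : measurable_fun D (fun t => P t + F^\+ t) by exact: emeasurable_funD.
have mNF : measurable_fun D (fun t => N t + F^\- t) by exact: emeasurable_funD.
have PF0 t : D t -> 0 <= P t + F^\+ t by move=> Dt; rewrite adde_ge0// P0.
have NF0 t : D t -> 0 <= N t + F^\- t by move=> Dt; rewrite adde_ge0// N0.
have Nfin : \int[mu]_(t in D) N t < +oo.
  by apply: le_lt_trans PFfin; exact: ge0_le_integral.
have Fnfin : \int[mu]_(t in D) F^\- t < +oo.
  by apply: le_lt_trans Pfin; exact: ge0_le_integral.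
have NFfin : \int[mu]_(t in D) (N t + F^\- t) < +oo.
  by rewrite ge0_integralD//; exact: lte_add_pinfty.
have int0 (g : T -> \bar R) : (forall t, D t -> 0 <= g t) -> 0 <= \int[mu]_(t in D) g t.
  by move=> g0; exact: integral_ge0.
have intf (g : T -> \bar R) : (forall t, D t -> 0 <= g t) ->
   \int[mu]_(t in D) g t < +oo -> \int[mu]_(t in D) g t \is a fin_num.
  by move=> g0; rewrite ge0_fin_numE// int0.
have Fp0 t : D t -> 0 <= F^\+ t by [].
have Fn0 t : D t -> 0 <= F^\- t by [].
have S0 t : D t -> 0 <= (s t)%:E by move=> Dt; rewrite lee_fin s0.
pose iP := fine (\int[mu]_(t in D) P t).
pose iN := fine (\int[mu]_(t in D) N t).
pose iFp := fine (\int[mu]_(t in D) F^\+ t).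
pose iFn := fine (\int[mu]_(t in D) F^\- t).
exists (iP - iN + (iFp - iFn))%R; split.
  by rewrite [X in _ + X]integralE !EFinD !EFinN !fineK// ?intf.
apply: quadratic_bound; [exact/fine_ge0/int0|exact/fine_ge0/int0|move=> l l0].
have l20 : (0 < l ^+ 2)%R by rewrite exprn_gt0.
pose X t : \bar R := (l * 2)%:E * (s t)%:E + (l ^+ 2)%:E * (N t + F^\- t).
pose Y t : \bar R := (l ^+ 2)%:E * (P t + F^\+ t).
(* [W] is the positive part of the linear bound and a measurable minorant of [G]; where
   [P + F^+ = +oo] it is 0, as [X - Y] is then [-oo]. *)
pose W t : \bar R := maxe 0 (X t - Y t).
have mX : measurable_fun D X.
  apply: emeasurable_funD; apply: emeasurable_funM => //; exact/measurable_EFinP.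
have mY : measurable_fun D Y by apply: emeasurable_funM.
have mW : measurable_fun D W by apply: measurable_maxe => //; exact: emeasurable_funB.
have X0 t : D t -> 0 <= X t.
  by move=> Dt; rewrite adde_ge0// mule_ge0 ?lee_fin ?NF0 ?s0// ?mulr_ge0 ?ltW.
have Y0 t : D t -> 0 <= Y t.
  by move=> Dt; rewrite mule_ge0 ?lee_fin ?PF0// ltW.
have W0 t : 0 <= W t by rewrite le_max lexx.
have WG : \int[mu]_(t in D) W t <= \int[mu]_(t in D) G t.
  apply: ge0_le_integral_lower => // t Dt; rewrite ge_max G0//=.
  have [PFt|] := ltP (P t + F^\+ t) +oo; last first.
    by rewrite leye_eq /Y => /eqP ->; rewrite gt0_muley ?lte_fin// addeNy leNye.
  have NFt : N t + F^\- t < +oo.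
    have Pt : P t < +oo by apply: le_lt_trans PFt; rewrite leeDl.
    by apply: lte_add_pinfty; [exact: le_lt_trans (NP _ Dt) PFt|exact: le_lt_trans (FP _ Dt) Pt].
  apply: le_trans (HG t l Dt PFt l0).
  rewrite /X /Y -[in leLHS](@fineK _ (P t + F^\+ t)) ?ge0_fin_numE ?PF0//.
  rewrite -[in leLHS](@fineK _ (N t + F^\- t)) ?ge0_fin_numE ?NF0//.
  by rewrite -!EFinM -!EFinD lee_fin; lra.
have XYW : \int[mu]_(t in D) X t <= \int[mu]_(t in D) Y t + \int[mu]_(t in D) W t.
  rewrite -ge0_integralD//; apply: ge0_le_integral => //.
  - exact: emeasurable_funD.
  - move=> t Dt; have := Y0 t Dt; rewrite /W; case: (Y t) => [y _||]//.
      by rewrite addeC -leeBlDr// le_max lexx orbT.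
    by rewrite addye ?leey// -ltNye (lt_le_trans (ltNyr 0%R))// le_max lexx.
have iX : \int[mu]_(t in D) X t =
    (l * 2 * fine (\int[mu]_(t in D) (s t)%:E) + l ^+ 2 * (iN + iFn))%:E.
  rewrite ge0_integralD//; last 4 first.
  - by move=> t Dt; rewrite mule_ge0 ?S0// lee_fin mulr_ge0// ltW.
  - by apply: emeasurable_funM => //; exact/measurable_EFinP.
  - by move=> t Dt; rewrite mule_ge0 ?NF0// lee_fin ltW.
  - exact: emeasurable_funM.
  rewrite ge0_integralZl_EFin//; last 2 first.
  - exact/measurable_EFinP.
  - by rewrite mulr_ge0// ltW.
  rewrite ge0_integralZl_EFin//; last exact: ltW.
  rewrite ge0_integralD// -[X in _ + _ * (X + _)](fineK (intf _ N0 Nfin)).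
  rewrite -[X in _ + _ * (_ + X)](fineK (intf _ Fn0 Fnfin)).
  by rewrite -[X in _ * X + _](fineK (intf _ S0 Sfin)).
have iY : \int[mu]_(t in D) Y t = (l ^+ 2 * (iP + iFp))%:E.
  rewrite ge0_integralZl_EFin//; last exact: ltW.
  rewrite ge0_integralD// -[X in _ * (X + _)](fineK (intf _ P0 Pfin)).
  by rewrite -[X in _ * (_ + X)](fineK (intf _ Fp0 Fpfin)) -EFinD -EFinM.
have := le_trans XYW (leeD2l _ WG).
rewrite iX iY -[X in _ + X](fineK (intf _ G0 Gfin)) -EFinD lee_fin.
by move=> ?; lra.
Qed.

End energy.

(** * Positive and negative parts of differences and products *)

Section positive_parts.
Context d (T : measurableType d) (R : realType).
Variables (mu : {measure set T -> \bar R}) (D : set T).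
Hypothesis mD : measurable D.

Lemma integral_weighted_difference (w w' a b : T -> \bar R) :
  measurable_fun D w -> measurable_fun D w' ->
  measurable_fun D a -> measurable_fun D b ->
  (forall x, D x -> 0 <= w x) -> (forall x, D x -> 0 <= w' x) ->
  \int[mu]_(x in D) (w x * maxe 0 (b x - a x) + w' x * maxe 0 (a x - b x)) =
  \int[mu]_(x in D) (w x * maxe 0 (b x - a x)) +
  \int[mu]_(x in D) (w' x * maxe 0 (a x - b x)).
Proof.
move=> mw mw' ma mb w0 w'0.
have mx (u v : T -> \bar R) : measurable_fun D u -> measurable_fun D v ->
    measurable_fun D (fun x => maxe 0 (v x - u x)).
  move=> mu' mv; apply: measurable_maxe => //; exact: emeasurable_funB.
apply: ge0_integralD => //.
- by move=> x Dx; rewrite mule_ge0 ?w0// le_max lexx.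
- by apply: emeasurable_funM => //; exact: mx.
- by move=> x Dx; rewrite mule_ge0 ?w'0// le_max lexx.
- by apply: emeasurable_funM => //; exact: mx.
Qed.

End positive_parts.

Section positive_part_identities.
Context (R : realType).
Implicit Types (r x : R) (y : \bar R).

Lemma abse_difference x y :
  `|x%:E - y| = maxe 0 (x%:E - y) + maxe 0 (y - x%:E).
Proof.
case: y => [y||] /=.
- rewrite -!EFin_max -EFinD; congr EFin; case: (leP x y) => xy.
    rewrite ler0_norm ?subr_le0// (max_idPl _) ?subr_le0//.
    by rewrite (max_idPr _) ?subr_ge0// add0r opprB.
  rewrite gtr0_norm ?subr_gt0// (max_idPr _) ?subr_ge0 ?(ltW xy)//.
  by rewrite (max_idPl _) ?subr_le0 ?(ltW xy)// addr0.
- by rewrite (max_idPl _) ?leNye// (max_idPr _) ?leey.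
- by rewrite addey// (max_idPr _) ?leey// (max_idPl _) ?leNye// adde0.
Qed.

Lemma positive_part_product r x y :
  maxe (r%:E * (x%:E - y)) 0 =
  maxe r%:E 0 * maxe 0 (x%:E - y) + maxe (- r%:E) 0 * maxe 0 (y - x%:E).
Proof.
have [r0|r0] := leP 0%R r.
- rewrite (max_idPl (_ : 0 <= r%:E)) ?lee_fin// (max_idPr (_ : - r%:E <= 0)) ?lee_fin ?oppr_le0//.
  by rewrite mul0e adde0 maxC maxe_pMr ?lee_fin// mule0.
- rewrite (max_idPr (_ : r%:E <= 0)) ?lee_fin ?ltW// (max_idPl (_ : 0 <= - r%:E)) ?lee_fin ?oppr_ge0 ?ltW//.
  rewrite mul0e add0e maxC.
  have -> : r%:E * (x%:E - y) = (- r%:E) * (y - x%:E).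
    by rewrite -[x%:E - y]oppeK muleN -mulNe oppeB ?fin_num_adde_defr// addeC.
  by rewrite maxe_pMr ?lee_fin ?oppr_ge0 ?ltW// mule0.
Qed.

Lemma negative_part_product r x y :
  maxe (- (r%:E * (x%:E - y))) 0 =
  maxe (- r%:E) 0 * maxe 0 (x%:E - y) + maxe r%:E 0 * maxe 0 (y - x%:E).
Proof.
by rewrite -mulNe -EFinN positive_part_product EFinN oppeK.
Qed.

End positive_part_identities.

(** * Convexity of [Bsigma] and a local bound for [Hsigma] *)

Section admissible_family.
Context {R : realType} {d : nat}.
Local Notation mu := (leb R d).
Variables (Om : set (Rd R d)) (sigma : Rd R d -> R).
Hypotheses (mOm : measurable Om) (msigma : measurable_fun Om sigma).
Hypothesis adm : admissible sigma mOm.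
Hypothesis Bfin : forall m : R, (0 <= m)%R -> m%:E < mu Om ->
  mu.-integrable (Bdom Om sigma m) (EFin \o sigma).

Lemma admissible_family : sublevel_family mu Om sigma (Bdom Om sigma)
  (fun m => bsigma Om sigma m%:E) (emax Om sigma).
Proof.
split.
- by move=> m; exact: measurable_Bdom.
- by move=> m x [].
- by move=> m m'; exact: Bdom_homo.
- by move=> m; exact: Bdom0.
- by move=> m; exact: (measure_Bdom_min msigma adm).
- by move=> m; exact: (Bdom_sigma_le msigma adm).
- by move=> m; exact: (Bdom_sigma_ge msigma adm).
- by move=> m m' mm'; apply: bsigma_homo; rewrite lee_fin.
- by move=> m; exact: (bsigma_gtNy msigma adm).
- by move=> m; exact: (bsigma_lty mOm msigma).
- by move=> m; exact: (bsigma_emax msigma adm).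
- exact: (measure_Om_gt0 adm).
- exact: Bfin.
Qed.

Lemma Bext_lt m : m%:E <= mu Om -> Bext Om sigma m = Bsigma Om sigma m.
Proof.
by move=> mM; rewrite /Bext (max_idPl _) ?mul0e ?adde0// sube_le0.
Qed.

Lemma Bsigma_fin m : (0 <= m)%R -> m%:E < mu Om ->
  (fine (Bsigma Om sigma m))%:E = Bsigma Om sigma m.
Proof.
move=> m0 mM; rewrite fineK//; apply: integrable_fin_num; last exact: Bfin.
exact: measurable_Bdom.
Qed.

Lemma Bsigma_subgradient m k : (0 < m)%R -> m%:E < mu Om -> (0 <= k)%R ->
  k%:E < mu Om ->
  (fine (Bsigma Om sigma m) + fine (bsigma Om sigma m%:E) * (k - m) <=
   fine (Bsigma Om sigma k))%R.
Proof.
move=> m0 mM k0 kM; have bm : bsigma Om sigma m%:E = (fine (bsigma Om sigma m%:E))%:E.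
  rewrite fineK// fin_numElt (bsigma_gtNy msigma adm)//=.
  exact: (bsigma_lty mOm msigma).
have := Bx_subgradient mOm msigma admissible_family (ltW m0) bm k0.
rewrite -/(Bsigma Om sigma m) -/(Bsigma Om sigma k) -/(Bext Om sigma m) -/(Bext Om sigma k).
rewrite (Bext_lt (ltW mM)) (Bext_lt (ltW kM)) -(Bsigma_fin (ltW m0) mM) -(Bsigma_fin k0 kM).
by rewrite -EFinD lee_fin.
Qed.

(** A function with a supporting line at [z] lies below its chords there. *)
Lemma Bsigma_convex :
  convex_function [set m : R^o | (0 <= m)%R /\ m%:E < mu Om]
    (fun m => fine (Bsigma Om sigma m)).
Proof.
move=> t x y; rewrite !inE => -[x0 xM] [y0 yM].
rewrite !convRE /unstable.onem; set a := t%:num.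
have a0 : (0 <= a)%R by rewrite /a ge0.
have a1 : (0 <= 1 - a)%R by rewrite subr_ge0 /a le1.
have -> : conv t x y = (a * x + (1 - a) * y)%R by exact: convRE.
set z := (a * x + (1 - a) * y)%R.
have B0 : fine (Bsigma Om sigma 0) = 0%R by rewrite /Bsigma Bdom0// integral_set0.
have z0 : (0 <= z)%R by rewrite addr_ge0// mulr_ge0.
have zM : z%:E < mu Om.
  apply: (@le_lt_trans _ _ (Num.max x y)%:E); last first.
    by case: (leP x y) => _.
  rewrite lee_fin /z; have [xy|/ltW yx] := leP x y.
    by have := ler_wpM2l a0 xy; lra.
  by have := ler_wpM2l a1 yx; lra.
have scale (c u : R) : (0 <= c)%R -> (c * u = 0)%R ->
    (c * fine (Bsigma Om sigma u) = 0)%R.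
  by move=> _ /eqP; rewrite mulf_eq0 => /orP[] /eqP ->; rewrite ?mul0r ?B0 ?mulr0.
(* At [z = 0] the slope [b 0] may be [-oo]; but then [a x] and [(1 - a) y] both vanish, and
   [B 0 = 0] makes both sides 0. *)
move: z0; rewrite le_eqVlt => /predU1P[z00|zp].
  have ax0 : (0 <= a * x)%R by rewrite mulr_ge0.
  have ay0 : (0 <= (1 - a) * y)%R by rewrite mulr_ge0.
  rewrite -z00 B0 (scale a)//; last by move: z00; rewrite /z; lra.
  by rewrite (scale (1 - a)%R) ?addr0//; move: z00; rewrite /z; lra.
have := ler_wpM2l a0 (Bsigma_subgradient zp zM x0 xM).
have := ler_wpM2l a1 (Bsigma_subgradient zp zM y0 yM).
set c := fine (bsigma _ _ _); have -> : (y - z = - a * (x - y))%R by rewrite /z; ring.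
have -> : (x - z = (1 - a) * (x - y))%R by rewrite /z; ring.
by move=> h1 h2; lra.
Qed.

(** The subgradient inequalities at [m + e] and [m - e], evaluated at [m], bound the second
    difference of step [e] by [e] times the variation of [b]. This serves the case [K = 0]. *)
Lemma Hsigma_le m e : (0 < e)%R -> (e < m)%R -> (m + e)%:E < mu Om ->
  Hsigma Om sigma m <=
  ((fine (bsigma Om sigma (m + e)%:E) - fine (bsigma Om sigma (m - e)%:E)) / e)%:E.
Proof.
move=> e0 em meM; have me0 : (0 < m - e)%R by rewrite subr_gt0.
have m0 : (0 < m)%R by exact: lt_trans e0 em.
have le_lt k : (k <= m + e)%R -> k%:E < mu Om.
  by move=> ke; apply: le_lt_trans meM; rewrite lee_fin.
have mM : m%:E < mu Om by apply: le_lt; rewrite lerDl ltW.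
have mme : (m - e)%:E < mu Om by apply: le_lt; lra.
have pe0 : (0 < m + e)%R by rewrite addr_gt0.
apply: (@le_trans _ _ (Bdiff2 Om sigma m e * ((e ^+ 2)^-1)%:E)).
  by apply: ereal_inf_lbound; exists e => //=; rewrite e0 ltW.
rewrite /Bdiff2 !Bext_lt ?(ltW mM) ?(ltW mme) ?(ltW meM)//.
rewrite -(Bsigma_fin (ltW m0) mM) -(Bsigma_fin (ltW me0) mme) -(Bsigma_fin (ltW pe0) meM).
set x := fine (Bsigma _ _ (m + e)); set y := fine (Bsigma _ _ (m - e)).
set z := fine (Bsigma _ _ m); set u := fine (bsigma _ _ _); set v := fine (bsigma _ _ _).
have -> : (x%:E + y%:E - 2%:E * z%:E)%dE = (x + y - 2 * z)%:E :> \bar R by [].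
have h1 : (x + u * (m - (m + e)) <= z)%R.
  exact: (Bsigma_subgradient pe0 meM (ltW m0) mM).
have h2 : (y + v * (m - (m - e)) <= z)%R.
  exact: (Bsigma_subgradient me0 mme (ltW m0) mM).
rewrite -EFinM lee_fin ler_pdivrMr ?exprn_gt0//.
have -> : ((u - v) / e * e ^+ 2 = (u - v) * e)%R by field; rewrite gt_eqF.
by lra.
Qed.

End admissible_family.

(** * Integration over all levels *)

Section exchange_levels.
Context {R : realType} {d : nat}.
Local Notation mu := (leb R d).
Local Notation leb1 := (@lebesgue_measure R).
Local Notation D := (`]0%R, +oo[%classic : set R).
Hypothesis hd : (0 < d)%N.
Variables (Om : set (Rd R d)) (sigma : Rd R d -> R).
Hypotheses (mOm : measurable Om) (msigma : measurable_fun Om sigma).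
Hypothesis adm : admissible sigma mOm.
Hypothesis Bfin : forall m : R, (0 <= m)%R -> m%:E < mu Om ->
  mu.-integrable (Bdom Om sigma m) (EFin \o sigma).
Variables q f : Rd R d -> R.
Hypotheses (iq : mu.-integrable Om (EFin \o q)) (i_f : mu.-integrable Om (EFin \o f)).
Hypotheses (q0 : {ae mu, forall x, Om x -> (0 <= q x)%R})
  (f0 : {ae mu, forall x, Om x -> (0 <= f x)%R}).

Let mq : measurable_fun Om q.
Proof. by apply/measurable_EFinP; exact: measurable_int iq. Qed.
Let mf : measurable_fun Om f.
Proof. by apply/measurable_EFinP; exact: measurable_int i_f. Qed.

Let m t := fine (mudist Om q t).
Let E t := Bdom Om sigma (m t).
Let A t := [set x | Om x /\ (t < f x)%R].
Let U t := A t `\` E t.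
Let V t := E t `\` A t.
Let Q := qsigma Om sigma q.
Let sig := EFin \o sigma.

(** Holds because [Q] is a nonincreasing function of [sigma]. *)
Lemma measurable_qsigma : measurable_fun Om Q.
Proof.
pose g e := if e%:E < emax Om sigma then qsharp Om q (asigma Om sigma e) else 0.
have mg : measurable_fun setT g.
  apply: nonincreasing_emeasurable => x y xy; rewrite /g.
  case: ifPn => ye; last by case: ifPn => // _; exact: qsharp_ge0.
  rewrite (le_lt_trans _ ye) ?lee_fin//.
  apply: le_ereal_inf => _ [t [t0 th] <-]; exists t => //; split => //.
  exact: le_trans th (asigma_homo mOm msigma xy).
exact: (measurableT_comp mg msigma).
Qed.
Let mQ := measurable_qsigma.

Let Dgt0 t : D t -> (0 < t)%R. Proof. by rewrite /= in_itv/= andbT. Qed.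

Let mE_ t : (0 < t)%R -> (m t)%:E = mudist Om q t.
Proof. by move=> t0; rewrite fineK// ge0_fin_numE ?mudist_ge0// mudist_lty. Qed.
Let m0 t : (0 <= m t)%R. Proof. by rewrite fine_ge0// mudist_ge0. Qed.
Let mM t : (0 < t)%R -> (m t)%:E <= mu Om.
Proof. by move=> /mE_ ->; exact: mudist_le. Qed.
Let mEm t : measurable (E t). Proof. exact: measurable_Bdom. Qed.
Let mA t : measurable (A t). Proof. exact: measurable_superlevel. Qed.
Let mU t : measurable (U t). Proof. exact: measurableD. Qed.
Let mV t : measurable (V t). Proof. exact: measurableD. Qed.
Let Afin t : (0 < t)%R -> mu (A t) < +oo.
Proof. exact: mudist_lty. Qed.
Let muE t : (0 < t)%R -> mu (E t) = (m t)%:E.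
Proof. by move=> t0; apply: (measure_Bdom_adm msigma adm) => //; exact: mM. Qed.
Let AOm t : A t `<=` Om. Proof. by move=> x []. Qed.

Let ltQ t x : (0 < t)%R -> Om x -> t%:E < Q x <-> E t x.
Proof.
move=> t0 Ox; apply: lt_qsigma => //; last exact: mudist_lty.
  by move=> y; exact: (emax_measure msigma adm).
exact: ltW.
Qed.

Let bandU t : (0 < t)%R -> band Om Q (EFin \o f) t = U t.
Proof.
move=> t0; apply/seteqP; split => x /=.
  move=> [Ox /andP[Qt tf]]; split; first by split => //; rewrite -lte_fin.
  by move=> /(ltQ t0 Ox); rewrite ltNge Qt.
move=> [[Ox tf] nE]; split => //; rewrite lte_fin tf andbT leNgt.
by apply/negP => /(ltQ t0 Ox).
Qed.

Let bandV t : (0 < t)%R -> band Om (EFin \o f) Q t = V t.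
Proof.
move=> t0; apply/seteqP; split => x /=.
  move=> [Ox /andP[ft Qt]]; split; first exact/ltQ.
  by move=> [_]; rewrite ltNge -lee_fin ft.
move=> [Ex nA]; have Ox : Om x by case: Ex.
split => //; apply/andP; split; last exact/ltQ.
by rewrite lee_fin leNgt; apply/negP => tf; apply: nA.
Qed.

Let f0' : {ae mu, forall x, Om x -> 0 <= (EFin \o f) x}.
Proof. by apply: filterS f0 => x h Ox /=; rewrite lee_fin h. Qed.
Let Q0' : {ae mu, forall x, Om x -> 0 <= Q x}.
Proof. by apply: aeW => x _; exact: qsigma_ge0. Qed.
Let mf' : measurable_fun Om (EFin \o f). Proof. exact/measurable_EFinP. Qed.

Let integral_eqD (g h : R -> \bar R) : (forall t, (0 < t)%R -> g t = h t) ->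
  \int[leb1]_(t in D) g t = \int[leb1]_(t in D) h t.
Proof. by move=> gh; apply: eq_integral => t; rewrite inE => /Dgt0/gh. Qed.

Let eq_measurableD (g h : R -> \bar R) : (forall t, (0 < t)%R -> g t = h t) ->
  measurable_fun D g -> measurable_fun D h.
Proof. by move=> gh; apply: eq_measurable_fun => t; rewrite inE => /Dgt0/gh. Qed.

Let cakeU w : measurable_fun Om w -> (forall x, Om x -> 0 <= w x) ->
  measurable_fun D (fun t => \int[mu]_(x in U t) w x) /\
  \int[mu]_(x in Om) (w x * maxe 0 ((f x)%:E - Q x)) =
  \int[leb1]_(t in D) \int[mu]_(x in U t) w x.
Proof.
move=> mw w0; have [h1 h2] := layer_cake_pos mOm mw mQ mf' w0 Q0'.
have e t : (0 < t)%R -> \int[mu]_(x in band Om Q (EFin \o f) t) w x =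
    \int[mu]_(x in U t) w x by move=> t0; rewrite bandU.
by split; [exact: eq_measurableD e h1|rewrite -(integral_eqD e) -h2].
Qed.

Let cakeV w : measurable_fun Om w -> (forall x, Om x -> 0 <= w x) ->
  measurable_fun D (fun t => \int[mu]_(x in V t) w x) /\
  \int[mu]_(x in Om) (w x * maxe 0 (Q x - (f x)%:E)) =
  \int[leb1]_(t in D) \int[mu]_(x in V t) w x.
Proof.
move=> mw w0; have [h1 h2] := layer_cake_pos mOm mw mf' mQ w0 f0'.
have e t : (0 < t)%R -> \int[mu]_(x in band Om (EFin \o f) Q t) w x =
    \int[mu]_(x in V t) w x by move=> t0; rewrite bandV.
by split; [exact: eq_measurableD e h1|rewrite -(integral_eqD e) -h2].
Qed.

Let p t := fine (mu (U t)).
Let s t := fine (mu (V t)).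

Let pE t : (0 < t)%R -> mu (U t) = (p t)%:E.
Proof.
move=> t0; rewrite fineK// ge0_fin_numE ?measure_ge0//.
by apply: le_lt_trans (Afin t0); apply: le_measure; rewrite ?inE//; exact: subDsetl.
Qed.

Let sE t : (0 < t)%R -> mu (V t) = (s t)%:E.
Proof.
move=> t0; rewrite fineK// ge0_fin_numE ?measure_ge0//.
apply: (@le_lt_trans _ _ (mu (E t))); last by rewrite muE// ltry.
by apply: le_measure; rewrite ?inE//; exact: subDsetl.
Qed.

Let p0 t : (0 <= p t)%R. Proof. exact/fine_ge0/measure_ge0. Qed.
Let s0 t : (0 <= s t)%R. Proof. exact/fine_ge0/measure_ge0. Qed.

(** Both sides measure the union of [E t] and [A t], cut in the two possible ways. *)
Let pm_sm t : (0 < t)%R -> (p t + m t = s t + fine (mudist Om f t))%R.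
Proof.
move=> t0; have Ufin : mu (U t) < +oo by rewrite pE// ltry.
have Vfin : mu (V t) < +oo by rewrite sE// ltry.
have Efin : mu (E t) < +oo by rewrite muE// ltry.
have -> : m t = fine (mu (E t)) by rewrite muE.
rewrite -[mudist Om f t]/(mu (A t)) /p /s.
rewrite -(fine_measureU (mU t) (mEm t) _ Ufin Efin); last by apply/disj_setPS => x [[]].
rewrite -(fine_measureU (mV t) (mA t) _ Vfin (Afin t0)); last by apply/disj_setPS => x [[]].
congr (fine (mu _)); apply/seteqP; split => x.
  move=> [[Ax _]|Ex]; first by right.
  by have [Ax|nA] := pselect (A t x); [right|left].
move=> [[Ex _]|Ax]; first by right.
by have [Ex|nE] := pselect (E t x); [right|left].
Qed.

Let m1 : measurable_fun Om (cst 1 : Rd R d -> \bar R). Proof. exact: measurable_cst. Qed.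

Let int1 (S : set (Rd R d)) : measurable S -> \int[mu]_(x in S) cst 1 x = mu S.
Proof. by move=> mS; rewrite integral_cst// mul1e. Qed.

Let mp : measurable_fun D (fun t => (p t)%:E).
Proof.
have [h _] := cakeU m1 (fun _ _ => lee01).
apply: eq_measurableD h => t t0.
by rewrite int1// pE.
Qed.

Let ms : measurable_fun D (fun t => (s t)%:E).
Proof.
have [h _] := cakeV m1 (fun _ _ => lee01).
apply: eq_measurableD h => t t0.
by rewrite int1// sE.
Qed.

Let norm_cake (g : Rd R d -> R) : mu.-integrable Om (EFin \o g) ->
  {ae mu, forall x, Om x -> (0 <= g x)%R} ->
  L1norm Om (EFin \o g) = \int[leb1]_(t in D) (fine (mudist Om g t))%:E.
Proof.
move=> ig g0; have mg : measurable_fun Om g by apply/measurable_EFinP; exact: measurable_int ig.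
rewrite /L1norm; have -> := norm_layer_cake mOm mg g0.
apply: integral_eqD => t t0; rewrite fineK//.
by rewrite ge0_fin_numE ?mudist_ge0// mudist_lty.
Qed.

Let ints_lty : \int[leb1]_(t in D) (s t)%:E < +oo.
Proof.
apply: (@le_lt_trans _ _ (L1norm Om (EFin \o q))); last by move/integrableP : iq => [].
rewrite norm_cake//; apply: ge0_le_integral_lower => t Dt; first by rewrite lee_fin.
have t0 := Dgt0 Dt; rewrite -sE// mE_// -mE_// -muE//.
by apply: le_measure; rewrite ?inE//; exact: subDsetl.
Qed.

Let msig : measurable_fun Om sig. Proof. exact/measurable_EFinP. Qed.
Let msp : measurable_fun Om sig^\+. Proof. exact: measurable_funepos. Qed.
Let msn : measurable_fun Om sig^\-. Proof. exact: measurable_funeneg. Qed.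
Let sp0 x : Om x -> 0 <= sig^\+ x. Proof. by []. Qed.
Let sn0 x : Om x -> 0 <= sig^\- x. Proof. by []. Qed.

(** The norm of [f - Q] is the integral of [p + s], and [pm_sm] turns the difference of the norms of
    [q] and [f] into the integral of [s - p]. *)
Lemma exchange_L1norm :
  L1norm Om (fun x => (f x)%:E - Q x) + L1norm Om (EFin \o q) - L1norm Om (EFin \o f) =
  (2 * fine (\int[leb1]_(t in D) (s t)%:E))%:E.
Proof.
have normE : L1norm Om (fun x => (f x)%:E - Q x) =
    \int[leb1]_(t in D) (p t)%:E + \int[leb1]_(t in D) (s t)%:E.
  transitivity (\int[mu]_(x in Om) (cst 1 x * maxe 0 ((f x)%:E - Q x) +
      cst 1 x * maxe 0 (Q x - (f x)%:E))).
    by rewrite /L1norm; apply: eq_integral => x _; rewrite /= !mul1e abse_difference.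
  rewrite (integral_weighted_difference mu mOm m1 m1 mQ mf' (fun _ _ => lee01) (fun _ _ => lee01)).
  rewrite (cakeU m1 (fun _ _ => lee01)).2 (cakeV m1 (fun _ _ => lee01)).2.
  by congr (_ + _); apply: integral_eqD => t t0; rewrite int1// ?pE// sE.
have mmg (g : Rd R d -> R) : measurable_fun Om g ->
    mu.-integrable Om (EFin \o g) ->
    measurable_fun D (fun t => (fine (mudist Om g t))%:E).
  move=> mg ig; apply: (@eq_measurableD (mudist Om g)).
    by move=> t t0; rewrite fineK// ge0_fin_numE ?mudist_ge0// mudist_lty.
  by apply: measurable_funTS; apply: nonincreasing_emeasurable; exact: mudist_homo.
(* Stated as an equality of sums, because the integral of [p] is not yet known to be finite. *)
have bal : \int[leb1]_(t in D) (p t)%:E + L1norm Om (EFin \o q) =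
    \int[leb1]_(t in D) (s t)%:E + L1norm Om (EFin \o f).
  have mD : measurable D by exact: measurable_itv.
  have intDD (g h : R -> R) : (forall t, 0 <= g t)%R -> (forall t, 0 <= h t)%R ->
      measurable_fun D (EFin \o g) -> measurable_fun D (EFin \o h) ->
      \int[leb1]_(t in D) (g t)%:E + \int[leb1]_(t in D) (h t)%:E =
      \int[leb1]_(t in D) ((g t)%:E + (h t)%:E).
    move=> g0 h0 mg mh.
    have g0' t : D t -> 0 <= (EFin \o g) t by rewrite /= lee_fin.
    have h0' t : D t -> 0 <= (EFin \o h) t by rewrite /= lee_fin.
    exact: esym (ge0_integralD leb1 mD g0' mg h0' mh).
  have g0m (g : Rd R d -> R) t : (0 <= fine (mudist Om g t))%R.
    by rewrite fine_ge0// mudist_ge0.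
  rewrite (norm_cake iq q0) (norm_cake i_f f0).
  rewrite (intDD _ _ p0 (g0m q) mp (mmg q mq iq)) (intDD _ _ s0 (g0m f) ms (mmg f mf i_f)).
  by apply: integral_eqD => t t0; rewrite -!EFinD pm_sm.
have fnorm (g : Rd R d -> R) : mu.-integrable Om (EFin \o g) ->
    L1norm Om (EFin \o g) \is a fin_num.
  move=> /integrableP[_ gfin]; rewrite ge0_fin_numE//.
  exact: integral_ge0.
have Sf : \int[leb1]_(t in D) (s t)%:E \is a fin_num.
  by rewrite ge0_fin_numE// integral_ge0// => t _; rewrite lee_fin.
rewrite normE [X in X - _ = _]addeAC bal.
rewrite -(fineK Sf) -(fineK (fnorm _ i_f)) -!EFinD; congr EFin.
by rewrite mulr_natl mulr2n; lra.
Qed.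

Let P t := \int[mu]_(x in U t) sig^\+ x + \int[mu]_(x in V t) sig^\- x.
Let N t := \int[mu]_(x in U t) sig^\- x + \int[mu]_(x in V t) sig^\+ x.
Let F := beta_term Om sigma f q.
Let b := bsigma Om sigma.

Let mP : measurable_fun D P.
Proof. exact: emeasurable_funD (cakeU msp sp0).1 (cakeV msn sn0).1. Qed.
Let mN : measurable_fun D N.
Proof. exact: emeasurable_funD (cakeU msn sn0).1 (cakeV msp sp0).1. Qed.
Let P0 t : 0 <= P t. Proof. by rewrite adde_ge0// integral_ge0. Qed.
Let N0 t : 0 <= N t. Proof. by rewrite adde_ge0// integral_ge0. Qed.

Let int_split (g h : R -> \bar R) : measurable_fun D g -> measurable_fun D h ->
  (forall t, 0 <= g t) -> (forall t, 0 <= h t) ->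
  \int[leb1]_(t in D) g t + \int[leb1]_(t in D) h t =
  \int[leb1]_(t in D) (g t + h t).
Proof.
move=> mg mh g0 h0; have mD : measurable D by exact: measurable_itv.
exact: esym (ge0_integralD leb1 mD (fun t _ => g0 t) mg (fun t _ => h0 t) mh).
Qed.

Lemma exchange_sigma_pos :
  \int[mu]_(x in Om) (sigma_term Om sigma f q)^\+ x = \int[leb1]_(t in D) P t.
Proof.
transitivity (\int[mu]_(x in Om) (sig^\+ x * maxe 0 ((f x)%:E - Q x) +
    sig^\- x * maxe 0 (Q x - (f x)%:E))).
  apply: eq_integral => x _.
  by rewrite funeposE positive_part_product funeposE funenegE.
rewrite (integral_weighted_difference mu mOm msp msn mQ mf' sp0 sn0).
rewrite (cakeU msp sp0).2 (cakeV msn sn0).2.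
apply: int_split; [exact: (cakeU msp sp0).1|exact: (cakeV msn sn0).1|..].
  by move=> t; exact: integral_ge0.
by move=> t; exact: integral_ge0.
Qed.

Lemma exchange_sigma_neg :
  \int[mu]_(x in Om) (sigma_term Om sigma f q)^\- x = \int[leb1]_(t in D) N t.
Proof.
transitivity (\int[mu]_(x in Om) (sig^\- x * maxe 0 ((f x)%:E - Q x) +
    sig^\+ x * maxe 0 (Q x - (f x)%:E))).
  apply: eq_integral => x _.
  by rewrite funenegE negative_part_product funeposE funenegE.
rewrite (integral_weighted_difference mu mOm msn msp mQ mf' sn0 sp0).
rewrite (cakeU msn sn0).2 (cakeV msp sp0).2.
apply: int_split; [exact: (cakeU msn sn0).1|exact: (cakeV msp sp0).1|..].
  by move=> t; exact: integral_ge0.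
by move=> t; exact: integral_ge0.
Qed.

(** The [beta] factors are the positive parts of [s - p] and [p - s], so [beta_term] is the [defect]
    of the one-level exchange. *)
Let FE t : (0 < t)%R -> F t = (Num.max 0 (s t - p t))%:E * b (2 * m t)%:E -
  (Num.max 0 (p t - s t))%:E * b (m t)%:E.
Proof.
move=> t0; have ft : mudist Om f t < +oo by exact: mudist_lty.
have qt : mudist Om q t < +oo by exact: mudist_lty.
rewrite /F /beta_term !(betaE mOm hd)// ?(ltW t0)//.
have e1 : (fine (mudist Om q t) - fine (mudist Om f t) = s t - p t)%R.
  by have := pm_sm t0; rewrite /m; lra.
have e2 : (fine (mudist Om f t) - fine (mudist Om q t) = p t - s t)%R.
  by have := pm_sm t0; rewrite /m; lra.
by rewrite e1 e2 -(mE_ t0) -EFinM.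
Qed.

Let mF : measurable_fun D F.
Proof.
have mb c : (0 <= c)%R -> measurable_fun D (fun t => b (c%:E * mudist Om q t)).
  move=> c0; apply: measurable_funTS; apply: nonincreasing_emeasurable => x y xy.
  by apply: bsigma_homo; rewrite lee_wpmul2l ?lee_fin//; exact: mudist_homo.
have mm (g h : R -> R) : measurable_fun D (EFin \o g) -> measurable_fun D (EFin \o h) ->
    measurable_fun D (fun t => (Num.max 0 (g t - h t))%:E).
  move=> /measurable_EFinP mg /measurable_EFinP mh; apply/measurable_EFinP.
  by apply: measurable_maxr => //; exact: measurable_funB.
apply: (@eq_measurableD (fun t =>
  (Num.max 0 (s t - p t))%:E * b (2%:E * mudist Om q t) -
  (Num.max 0 (p t - s t))%:E * b (1%:E * mudist Om q t))).
  by move=> t t0; rewrite FE// -(mE_ t0) mul1e -EFinM.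
apply: emeasurable_funB; apply: emeasurable_funM.
- exact: mm.
- exact: mb.
- exact: mm.
- exact: mb.
Qed.

Let slf := admissible_family msigma adm Bfin.

Let NP t : (0 < t)%R -> N t <= P t + F^\+ t.
Proof.
move=> t0; have [h _] := exchange_balance mOm msigma slf (mA t) (@AOm t) (Afin t0) (m0 t).
by rewrite funeposE FE.
Qed.

Let FP t : (0 < t)%R -> F^\- t <= P t.
Proof.
move=> t0; have [_ h] := exchange_balance mOm msigma slf (mA t) (@AOm t) (Afin t0) (m0 t).
by rewrite funenegE FE.
Qed.

Lemma mudist_Linfnorm t : (0 < t)%R -> Linfnorm mOm (EFin \o q) <= t%:E ->
  mudist Om q t = 0.
Proof.
move=> t0; rewrite /Linfnorm Lnorm.unlock.
have -> : (0 < mrestr mu mOm setT)%E by rewrite /mrestr setTI; exact: (measure_Om_gt0 adm).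
move=> /ess_supP[Z [mZ Z0 hZ]]; apply/eqP; rewrite eq_le measure_ge0 andbT.
rewrite -Z0 /mrestr; apply: le_measure; rewrite ?inE.
- exact: measurable_superlevel.
- exact: measurableI.
- move=> x [Ox tq]; split => //; apply: hZ => /=; apply/negP; rewrite -ltNge lte_fin.
  exact: lt_le_trans tq (ler_norm _).
Qed.

Let L := Linfnorm mOm (EFin \o q).
(** Extended by 0 beyond the norm of [q], where [E t] is empty and [s t = 0], so that all integrals
    run over [D]. *)
Let G t := if t%:E < L then (Hsigma Om sigma (m t))^-1 else 0.

Lemma Kqs_lower : Kqs sigma mOm q = 4%:E * \int[leb1]_(t in D) G t.
Proof.
rewrite /Kqs; congr (_ * _); rewrite integral_mkcond [RHS]integral_mkcond.
apply: eq_integral => t _; rewrite /patch !mem_setE /G /= in_itv/= andbT.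
rewrite -/L; case: ifPn => [|nt].
  by rewrite inE/= => -[t0 tL]; rewrite t0 tL.
case: ifPn => // t0; case: ifPn => // tL.
by move: nt; rewrite notin_setE /= => /(_ (conj t0 tL)).
Qed.

Let H0 t : (0 < t)%R -> 0 <= Hsigma Om sigma (m t).
Proof. by move=> t0; exact: (stiffness_ge0 mOm msigma slf (m0 t) (mM t0)). Qed.

Let G0 t : (0 < t)%R -> 0 <= G t.
Proof. by move=> t0; rewrite /G; case: ifP => // _; rewrite inve_ge0 H0. Qed.

Lemma Kqs_ge0 : 0 <= Kqs sigma mOm q.
Proof. by rewrite Kqs_lower mule_ge0// integral_ge0// => t /Dgt0/G0. Qed.

Let s_gt0_lt t : (0 < t)%R -> (0 < s t)%R -> t%:E < L.
Proof.
move=> t0 st; rewrite ltNge; apply/negP => /(mudist_Linfnorm t0) qt0.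
have mt0 : m t = 0%R by rewrite /m qt0.
by move: st; rewrite /s /V /E mt0 Bdom0// set0D measure0 ltxx.
Qed.

(** If [s t = 0], the left side is [- l^2 z] with [z >= 0]; otherwise [t] is below the norm of [q]
    and the one-level exchange feeds [stiffness_young]. *)
Let HG t l : (0 < t)%R -> P t + F^\+ t < +oo -> (0 < l)%R ->
  (l * (2 * s t) - l ^+ 2 * (fine (P t + F^\+ t)%E - fine (N t + F^\- t)%E))%:E <= G t.
Proof.
move=> t0; rewrite funeposE funenegE FE// => Pfin l0.
have [z0 hz] := exchange_second_difference mOm msigma slf (mA t) (@AOm t)
  (Afin t0) (m0 t) (mM t0) Pfin.
have [st|] := ltP 0%R (s t); last first.
  move=> st; apply: le_trans (G0 t0); rewrite lee_fin subr_le0.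
  apply: (@le_trans _ _ 0%R).
    by rewrite mulr_ge0_le0 ?(ltW l0)// mulr_ge0_le0.
  by rewrite mulr_ge0 ?sqr_ge0.
have [sm hs] := hz st.
rewrite /G s_gt0_lt//.
have ssm : (0 < s t <= m t)%R by rewrite st.
exact: (stiffness_young mOm msigma slf l (m0 t) (mM t0) ssm hs).
Qed.

Lemma exchange_inequality :
  let I1 := \int[mu]_(x in Om) sigma_term Om sigma f q x in
  let I2 := \int[leb1]_(t in `[0%R, +oo[) beta_term Om sigma f q t in
  Kqs sigma mOm q < +oo ->
  integral_exists mu Om (sigma_term Om sigma f q) ->
  integral_exists leb1 `[0%R, +oo[ (beta_term Om sigma f q) ->
  I1 +? I2 -> Kqs sigma mOm q *? (I1 + I2) ->
  (L1norm Om (fun x => (f x)%:E - Q x) + L1norm Om (EFin \o q)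
     - L1norm Om (EFin \o f)) ^+ 2 <= Kqs sigma mOm q * (I1 + I2).
Proof.
move=> I1 I2 Kfin; rewrite exchange_L1norm /integral_exists.
have mD : measurable D by exact: measurable_itv.
have cl (g : R -> \bar R) : measurable_fun D g ->
    \int[leb1]_(t in `[0%R, +oo[) g t = \int[leb1]_(t in D) g t.
  by move=> mg; rewrite -integral_itv_obnd_cbnd.
have mFp : measurable_fun D F^\+ by exact: measurable_funepos.
have mFn : measurable_fun D F^\- by exact: measurable_funeneg.
rewrite exchange_sigma_pos exchange_sigma_neg -/F (cl _ mFp) (cl _ mFn).
have -> : I1 = \int[leb1]_(t in D) P t - \int[leb1]_(t in D) N t.
  by rewrite /I1 integralE exchange_sigma_pos exchange_sigma_neg.
have -> : I2 = \int[leb1]_(t in D) F t by rewrite /I2 cl.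
have K0 := Kqs_ge0.
(* If one of these integrals is infinite, the existence hypotheses rule out cancellation and the
   bracket is [+oo]; then [*?] excludes [K = 0], so the right-hand side is [+oo]. *)
have [[Pfin Fpfin] _ _ _ _|infinite] := pselect (\int[leb1]_(t in D) P t < +oo /\
    \int[leb1]_(t in D) F^\+ t < +oo).
  have Gfin : \int[leb1]_(t in D) G t < +oo.
    move: Kfin; rewrite Kqs_lower !ltey; apply: contra => /eqP ->.
    by rewrite gt0_muley ?lte_fin.
  have GI0 : 0 <= \int[leb1]_(t in D) G t by apply: integral_ge0 => t /Dgt0/G0.
  have ms' : measurable_fun D s by exact/measurable_EFinP.
  have [Z [ZE hZ]] := energy_bound (mu := leb1) mD mP mN mF ms' (fun t _ => P0 t) (fun t _ => N0 t)
    (fun t _ => s0 t) (fun t Dt => G0 (Dgt0 Dt)) (fun t Dt => NP (Dgt0 Dt))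
    (fun t Dt => FP (Dgt0 Dt)) (fun t l Dt => @HG t l (Dgt0 Dt)) ints_lty Gfin Pfin Fpfin.
  rewrite ZE Kqs_lower -[X in _ * X * _](@fineK _ (\int[leb1]_(t in D) G t)); last first.
    by rewrite ge0_fin_numE.
  by rewrite -!EFinM -EFin_expe lee_fin.
move=> e1 e2 e3.
have -> : \int[leb1]_(t in D) P t - \int[leb1]_(t in D) N t +
    \int[leb1]_(t in D) F t = +oo.
  have [Py|nPy] := eqVneq (\int[leb1]_(t in D) P t) +oo.
    move: e3; rewrite Py.
    have -> : +oo - \int[leb1]_(t in D) N t = +oo.
      by move: e1; rewrite Py; case: (\int[leb1]_(t in D) N t).
    by case: (\int[leb1]_(t in D) F t).
  have Fy : \int[leb1]_(t in D) F^\+ t = +oo.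
    apply/eqP; rewrite -leye_eq leNgt; apply/negP => Ffin; apply: infinite.
    by rewrite ltey.
  have FIE : \int[leb1]_(t in D) F t =
      \int[leb1]_(t in D) F^\+ t - \int[leb1]_(t in D) F^\- t by exact: integralE.
  move: e3; rewrite FIE Fy.
  have -> : +oo - \int[leb1]_(t in D) F^\- t = +oo.
    by move: e2; rewrite Fy; case: (\int[leb1]_(t in D) F^\- t).
  by case: (_ - _).
move=> Kdef; have Kp : 0 < Kqs sigma mOm q.
  rewrite lt_neqAle K0 andbT eq_sym; apply/negP => /eqP Kz.
  by move: Kdef; rewrite Kz /mule_def /= ?eqxx.
by rewrite gt0_muley// leey.
Qed.

(** A single level is a null set, so a positive integral provides two levels with [s > 0]. *)
Let int_s_unique : (forall t t', (0 < t)%R -> (t < t')%R -> (0 < s t)%R ->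
  (0 < s t')%R -> False) -> \int[leb1]_(t in D) (s t)%:E = 0.
Proof.
move=> uniq; have mD : measurable D by exact: measurable_itv.
have snot t : ~ (0 < s t)%R -> s t = 0%R.
  by move/negP; rewrite -leNgt => st; apply/eqP; rewrite eq_le st s0.
have [[t0 [t00 st0]]|none] := pselect (exists t, (0 < t)%R /\ (0 < s t)%R); last first.
  apply: integral0_eq => t /Dgt0 t0; rewrite snot// => st.
  by apply: none; exists t.
have ae0 : ae_eq leb1 D (fun t => (s t)%:E) (cst 0).
  exists [set t0]; split; [exact: measurable_set1|exact: lebesgue_measure_set1|].
  move=> t /= /not_implyP[Dt snz]; have t0p := Dgt0 Dt.
  have {}st : (0 < s t)%R.
    by apply: contrapT => /snot st; apply: snz; rewrite st.
  case: (ltgtP t t0) => // tt.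
  - by exfalso; exact: (uniq t t0).
  - by exfalso; exact: (uniq t0 t).
by rewrite (ae_eq_integral (mu := leb1) (cst 0) _ mD ms (measurable_cst _) ae0) integral0.
Qed.

(* [H_sigma] is locally bounded on [0, meas Om[, so if [K] vanishes then the
   distribution function [m] takes at most one value in that open interval. *)
Lemma equimeasurable_gap0 : (forall t, (0 < t)%R -> fine (mudist Om f t) = m t) ->
  Kqs sigma mOm q = 0 -> \int[leb1]_(t in D) (s t)%:E = 0.
Proof.
move=> fm K0; apply: int_s_unique => t1 t2 t10 t12 st1 st2.
have t20 : (0 < t2)%R by exact: lt_trans t12.
(* Equimeasurability gives [p = s > 0] at [t1], so [Om] contains [U t1] of positive measure besides
   [E t1]. *)
have m1M : (m t1)%:E < mu Om.
  have ps : p t1 = s t1 by have := pm_sm t10; rewrite fm//; lra.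
  apply: (@lt_le_trans _ _ (m t1 + p t1)%:E); first by rewrite lte_fin ltrDl ps.
  have Ufin : mu (U t1) < +oo by rewrite pE// ltry.
  have Efin : mu (E t1) < +oo by rewrite muE// ltry.
  have UE : mu (U t1 `|` E t1) <= mu Om.
    apply: le_measure; rewrite ?inE//; first exact: measurableU.
    by move=> x [[/AOm]|[]].
  apply: le_trans UE; rewrite -[leRHS]fineK.
    rewrite lee_fin (fine_measureU (mU t1) (mEm t1) _ Ufin Efin).
      by rewrite -[leRHS]/(p t1 + fine (mu (E t1)))%R muE//= addrC.
    by apply/disj_setPS => x [[]].
  have -> : mu (U t1 `|` E t1) = mu (U t1) + mu (E t1).
    by apply: measureU => //; apply/eqP/disj_setPS => x [[]].
  by rewrite pE// muE.
have m2p : (0 < m t2)%R.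
  apply: lt_le_trans st2 _; rewrite -lee_fin -sE// -muE//.
  by apply: le_measure; rewrite ?inE//; exact: subDsetl.
have m_homo t t' : (0 < t)%R -> (t <= t')%R -> (m t' <= m t)%R.
  move=> tp tt'; rewrite -lee_fin mE_// ?(lt_le_trans tp)// mE_//.
  exact: mudist_homo.
have [k mk kM] : exists2 k, (m t1 < k)%R & k%:E < mu Om.
  move: m1M; case: (mu Om) => [M||]//.
    rewrite lte_fin => mM1; exists ((m t1 + M) / 2)%R; rewrite ?lte_fin; lra.
  by move=> _; exists (m t1 + 1)%R; rewrite ?ltry// ltrDl.
have k0 : (0 < k)%R by exact: le_lt_trans (m0 t1) mk.
(* With this step, [m t + e <= k] and [m t - e >= m t2 / 2] for every [t] between [t1] and [t2], so
   [Hsigma_le] gives a uniform bound. *)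
pose e : R := Num.min (k - m t1)%R (m t2 / 2)%R.
have e0 : (0 < e)%R by rewrite lt_min subr_gt0 mk divr_gt0.
have bfin r : (0 < r)%R -> r%:E < mu Om -> b r%:E \is a fin_num.
  by move=> r0 rM; rewrite fin_numElt (bsigma_gtNy msigma adm)//= bsigma_lty.
pose C := (`|(fine (b k%:E) - fine (b (m t2 / 2)%:E)) / e| + 1)%R.
have C0 : (0 < C)%R by rewrite ltr_wpDl.
have HC t : (t1 <= t <= t2)%R -> (C^-1)%:E <= G t.
  move=> /andP[t1t tt2]; have tp : (0 < t)%R by exact: lt_le_trans t1t.
  have tL : t%:E < L by apply: (le_lt_trans _ (s_gt0_lt t20 st2)); rewrite lee_fin.
  have mt1 : (m t <= m t1)%R by exact: m_homo.
  have mt2 : (m t2 <= m t)%R by exact: m_homo.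
  have ek : (e <= k - m t1)%R by rewrite ge_min lexx.
  have em : (e <= m t2 / 2)%R by rewrite ge_min lexx orbT.
  have etm : (e < m t)%R by lra.
  have mek : (m t + e <= k)%R by lra.
  have meM : (m t + e)%:E < mu Om by apply: (le_lt_trans _ kM); rewrite lee_fin.
  have me0 : (0 < m t - e)%R by rewrite subr_gt0.
  have mmeM : (m t - e)%:E < mu Om.
    by apply: (le_lt_trans _ meM); rewrite lee_fin; lra.
  have m2M : (m t2 / 2)%:E < mu Om.
    by apply: (le_lt_trans _ meM); rewrite lee_fin; lra.
  have b1 : (fine (b (m t + e)%:E) <= fine (b k%:E))%R.
    apply: fine_le; [apply: bfin => //; lra|exact: bfin|].
    by apply: bsigma_homo; rewrite lee_fin.
  have b2 : (fine (b (m t2 / 2)%:E) <= fine (b (m t - e)%:E))%R.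
    apply: fine_le; [by apply: bfin => //; rewrite divr_gt0|exact: bfin|].
    by apply: bsigma_homo; rewrite lee_fin; lra.
  rewrite /G tL -[(C^-1)%:E]/((C^-1)%:E) .
  have -> : (C^-1)%:E = (C%:E)^-1 by rewrite inver gt_eqF.
  rewrite lee_pV2 ?inE ?H0// ?lee_fin ?(ltW C0)//.
  apply: le_trans (Hsigma_le msigma adm Bfin e0 etm meM) _.
  rewrite lee_fin; apply: (@le_trans _ _ ((fine (b k%:E) - fine (b (m t2 / 2)%:E)) / e)%R).
    by rewrite ler_pM2r ?invr_gt0// lerB.
  by rewrite /C (le_trans (ler_norm _))// lerDl.
(* [G >= 1 / C] on an interval of positive length contradicts the zero integral of [G]. *)
have : 0 < \int[leb1]_(t in `[t1, t2]) (C^-1)%:E.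
  rewrite integral_cst//= lebesgue_measure_itv/= lte_fin t12 -EFinD -EFinM lte_fin.
  by rewrite mulr_gt0 ?invr_gt0// subr_gt0.
have GI : \int[leb1]_(t in D) G t = 0.
  by move: K0; rewrite Kqs_lower => /eqP; rewrite mule_eq0 => /orP[|/eqP//]; rewrite eqe pnatr_eq0.
rewrite ltNge -GI => /negP; apply.
rewrite [leLHS]integral_mkcond [leRHS]integral_mkcond; apply: ge0_le_integral_lower => t _.
  by apply: erestrict_ge0 => x _; rewrite lee_fin invr_ge0 ltW.
rewrite /patch !mem_setE /= !in_itv /= andbT; case: ifPn => [tt|_].
  by rewrite (lt_le_trans t10) ?HC//; case/andP: tt.
by case: ifPn => // /G0.
Qed.

End exchange_levels.

Theorem theorem1 (R : realType) (d : nat) (hd : (1 <= d)%N)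
    (Om : set (Rd R d)) (mOm : measurable Om)
    (sigma : Rd R d -> R) (msigma : measurable_fun Om sigma)
    (adm : admissible sigma mOm)
    (Bfin : forall m : R, (0 <= m)%R -> m%:E < leb R d Om ->
      (leb R d).-integrable (Bdom Om sigma m) (EFin \o sigma)) :
  [/\ convex_function [set m : R^o | (0 <= m)%R /\ m%:E < leb R d Om]
        (fun m => fine (Bsigma Om sigma m)),
      forall q : Rd R d -> R,
        (leb R d).-integrable Om (EFin \o q) ->
        {ae leb R d, forall x, Om x -> (0 <= q x)%R} ->
        ~ {ae leb R d, forall x, Om x -> q x = 0%R} ->
        Kqs sigma mOm q < +oo ->
        forall f : Rd R d -> R,
        (leb R d).-integrable Om (EFin \o f) ->
        {ae leb R d, forall x, Om x -> (0 <= f x)%R} ->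
        let I1 := \int[leb R d]_(x in Om) sigma_term Om sigma f q x in
        let I2 := \int[lebesgue_measure]_(s in `[0%R, +oo[)
                    beta_term Om sigma f q s in
        (* both integrals, their sum and the product are not indeterminate *)
        integral_exists (leb R d) Om (sigma_term Om sigma f q) ->
        integral_exists lebesgue_measure `[0%R, +oo[
          (beta_term Om sigma f q) ->
        I1 +? I2 ->
        Kqs sigma mOm q *? (I1 + I2) ->
        (L1norm Om (fun x => (f x)%:E - qsigma Om sigma q x)
           + L1norm Om (EFin \o q) - L1norm Om (EFin \o f)) ^+ 2
        <= Kqs sigma mOm q * (I1 + I2)
    & forall f : Rd R d -> R,
        (leb R d).-integrable Om (EFin \o f) ->
        {ae leb R d, forall x, Om x -> (0 <= f x)%R} ->
        Kqs sigma mOm f < +oo ->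
        integral_exists (leb R d) Om (sigma_term Om sigma f f) ->
        L1norm Om (fun x => (f x)%:E - qsigma Om sigma f x) ^+ 2
        <= Kqs sigma mOm f *
           \int[leb R d]_(x in Om) sigma_term Om sigma f f x].
Proof.
split; first exact: Bsigma_convex.
  move=> q iq q0 _ Kfin f i_f f0 I1 I2 e1 e2 e3 e4.
  exact: (exchange_inequality hd msigma adm Bfin iq i_f q0 f0).
move=> f i_f f0 Kfin e1.
have Nf : L1norm Om (EFin \o f) \is a fin_num.
  move: (i_f) => /integrableP[_ fi]; rewrite ge0_fin_numE//; exact: integral_ge0.
have LE : L1norm Om (fun x => (f x)%:E - qsigma Om sigma f x) +
    L1norm Om (EFin \o f) - L1norm Om (EFin \o f) =
    L1norm Om (fun x => (f x)%:E - qsigma Om sigma f x) by rewrite addeK.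
(* For [K = 0] the right-hand side is 0 even if the energy is infinite, so the left-hand side must
   vanish by itself. *)
have [K0|Kn0] := eqVneq (Kqs sigma mOm f) 0.
  have gap := equimeasurable_gap0 msigma adm Bfin i_f i_f f0 (fun t _ => erefl) K0.
  have := exchange_L1norm msigma adm i_f i_f f0 f0.
  by rewrite LE gap mulr0 => ->; rewrite K0 mul0e /= mule0.
(* With [q = f] both [beta] sets are empty, and the correction term disappears. *)
have B0 : beta_term Om sigma f f = cst 0.
  apply/funext => s; rewrite /beta_term.
  have -> : beta Om (qstar Om f) (qstar Om f) s = 0.
    rewrite /beta (_ : [set x | _] = set0) ?measure0//.
    by apply/seteqP; split => x // [_ [fs]]; rewrite ltNge fs.
  by rewrite !mul0e sube0.
have I20 : \int[lebesgue_measure]_(s in `[0%R, +oo[) beta_term Om sigma f f s = 0.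
  by rewrite B0 integral0.
have := exchange_inequality hd msigma adm Bfin i_f i_f f0 f0.
move=> /(_ Kfin e1); rewrite LE I20 adde0; apply.
- rewrite /integral_exists B0.
  have -> : (cst 0 : R -> \bar R)^\+ = cst 0 by apply/funext => s; rewrite funeposE maxxx.
  have -> : (cst 0 : R -> \bar R)^\- = cst 0.
    by apply/funext => s; rewrite funenegE oppe0 maxxx.
  by rewrite integral0 oppe0.
- by rewrite fin_num_adde_defl.
(* [K] is now positive and finite, so its product with any extended real is determinate. *)
- have := Kqs_ge0 msigma adm Bfin i_f.
  move: Kfin Kn0; case: (Kqs sigma mOm f) => [K||]//; rewrite eqe /mule_def.
  by case: (\int[_]_(x in _) _ x).
Qed.
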